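(* In the setting described in the context, the mapping $m\#a\mapsto ma\in M_1$ ($m\in M$, $a\in A$) defines an isomorphism between the smash product algebra $M\#A$ and the algebra $M_1$.
   Context: Conventions. $k$ is a field; algebras are unital associative $k$-algebras; summation over repeated indices (finite sums) is understood; $C_X(Y)$ is the centralizer of $Y$ in $X$; Sweedler notation $\Delta(h)=h_{(1)}\otimes h_{(2)}$ is used. Extensions. An algebra extension $M/N$ is Frobenius if there are an $N$-$N$-bimodule map $E:M\to N$ (Frobenius homomorphism) and finite families $\{x_i\},\{y_i\}$ in $M$ (dual bases for $E$) with $E(mx_i)y_i=m=x_iE(y_im)$ for all $m\in M$. It is strongly separable of index $\lambda^{-1}$ if also $E(1)=1$ and $x_iy_i=\lambda^{-1}1$ with $0\neq\lambda\in k$. It is a Markov extension if moreover there is a trace $T:N\to k$ (Markov trace) with $T(1)=1$ such that $T_0:=T\circ E$ is a trace on $M$. It is a symmetric Markov extension if moreover $E(ux)=E(xu)$ for all $x\in M$, $u\in U:=C_M(N)$. A $k$-algebra is Kanzaki separable if it has a separability element that is symmetric (invariant under the flip). Jones tower. $M_1=M\otimes_N M$, $e_1=1\otimes 1$, elements written $me_1m'=m\otimes m'$, product $(me_1m')(ne_1n')=mE(m'n)e_1n'$, unit $x_ie_1y_i$, $M\subset M_1$ via $m\mapsto mx_ie_1y_i$, and $E_M:M_1\to M$, $E_M(me_1m')=\lambda mm'$. $M_1/M$ is again a symmetric Markov extension of index $\lambda^{-1}$ with Frobenius homomorphism $E_M$ and Markov trace $T_0$. Iterating for $M_1/M$ gives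 $M_2=M_1e_2M_1$ and $E_{M_1}:M_2\to M_1$, $E_{M_1}(xe_2y)=\lambda xy$. Put $T_1=T_0\circ E_M$, $T_2=T_1\circ E_{M_1}$ (traces on $M_1$, $M_2$). Centralizers: $U=C_M(N)$, $V=C_{M_1}(M)$, $W=C_{M_2}(M_1)$, $A=C_{M_1}(N)$, $B=C_{M_2}(M)$, $C=C_{M_2}(N)$. $T$ also denotes the restriction of $T_2$ to $C$. Let $\phi:U\to V$, $\phi(u)=x_iue_1y_i$ (an algebra anti-isomorphism). Standing assumptions. (i) $M/N$ is a symmetric Markov extension. (ii) Symmetric product: $x_iy_i=y_ix_i=\lambda^{-1}1$ (alternatively, instead of $y_ix_i=\lambda^{-1}1$ one may assume $T_0|_U=T_1\circ\phi$). (iii) Weak irreducibility: $U$ is a Kanzaki separable $k$-algebra and $T_0|_U$ is a non-degenerate trace. (iv) Depth $2$: $E_M$ has dual bases lying in $A$, and $E_{M_1}$ has dual bases $\{u_j\},\{v_j\}$ lying in $B$. Structure on $A$. $f=f^{(1)}\otimes f^{(2)}$ is the unique symmetric separability element of $V$ and $w=[f^{(1)}T(f^{(2)})]^{-1}\in Z(V)$ (an invertible element of the center of $V$). The bilinear forms $\langle a,b\rangle=\lambda^{-2}T(ae_2e_1wb)$ and $\langle a,b\rangle'=\lambda^{-2}T(be_1e_2wa)$ on $A\times B$ are non-degenerate. Let $S_B:B\to B$ be the linear bijection with $\langle a,b\rangle=\langle a,S_B(b)\rangle'$ for all $a\in A$, $b\in B$. $A$ is a weak Hopf algebra with its algebra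 structure and: comultiplication defined by $\langle a_{(1)},b\rangle\langle a_{(2)},b'\rangle=\langle a,bb'\rangle$ for all $b,b'\in B$; counit $\varepsilon(a)=\langle a,1\rangle$; antipode $S:A\to A$ defined by $\langle S(a),b\rangle=\langle a,S_B(b)\rangle$ for all $b\in B$. $A$ acts on $M$ (making $M$ a left $A$-module algebra) by $a\triangleright m=a_{(1)}mS(a_{(2)})$. Smash product. For a weak Hopf algebra $H$ with target counital map $\varepsilon_t(h)=\varepsilon(1_{(1)}h)1_{(2)}$ and target counital subalgebra $H_t=\varepsilon_t(H)$, and a left $H$-module algebra $X$ (a left $H$-module with $h\cdot(xy)=(h_{(1)}\cdot x)(h_{(2)}\cdot y)$, $h\cdot1=\varepsilon_t(h)\cdot1$), the smash product $X\#H$ is the vector space $X\otimes_{H_t}H$, where $H$ is a left $H_t$-module by multiplication and $X$ is a right $H_t$-module by $x\cdot z=S^{-1}(z)\cdot x=x(z\cdot1)$; writing $x\#h$ for the class of $x\otimes h$, the product is $(x\#h)(y\#g)=x(h_{(1)}\cdot y)\#h_{(2)}g$ and the unit is $1\#1$. *)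

(* Defs.v *)
From HB Require Import structures.
From mathcomp Require Import all_boot all_order all_algebra.
From mathcomp Require Import boolp.
Set Implicit Arguments.
Unset Strict Implicit.
Unset Printing Implicit Defensive.
Import GRing.Theory.
Local Open Scope ring_scope.
Local Open Scope quotient_scope.

(* [tens ra la] is the tensor product of X and Y over k balanced along
   x.i (x) y = x (x) i.y, where [ra] and [la] are the actions of I on X and Y:
   formal finite sums of pairs (x, y) modulo the least k-linear congruence
   containing bilinearity and the balancing relations. The scalar in
   [tcong_bal] makes the congruence k-linear for an arbitrary [ra]. When I is
   a k-algebra, [tcong_scale] follows from balancing. *)
Section Tensor.
Variables (k : fieldType) (X Y : lmodType k) (I : Type).
Variables (ra : X -> I -> X) (la : I -> Y -> Y).

Inductive tcong : seq (X * Y) -> seq (X * Y) -> Prop :=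
| tcong_refl s : tcong s s
| tcong_sym s t : tcong s t -> tcong t s
| tcong_trans s t u : tcong s t -> tcong t u -> tcong s u
| tcong_cat s s' t t' : tcong s s' -> tcong t t' -> tcong (s ++ t) (s' ++ t')
| tcong_comm s t : tcong (s ++ t) (t ++ s)
| tcong_zero y : tcong [:: (0, y)] [::]
| tcong_addl x x' y : tcong [:: (x + x', y)] [:: (x, y); (x', y)]
| tcong_addr x y y' : tcong [:: (x, y + y')] [:: (x, y); (x, y')]
| tcong_scale c x y : tcong [:: (c *: x, y)] [:: (x, c *: y)]
| tcong_bal c x i y : tcong [:: (c *: ra x i, y)] [:: (c *: x, la i y)].

Definition tcongb : rel (seq (X * Y)) := fun s t => `[< tcong s t >].

Lemma tcongb_refl : reflexive tcongb.
Proof. by move=> s; apply/asboolP; apply: tcong_refl. Qed.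
Lemma tcongb_sym : symmetric tcongb.
Proof.
by move=> s t; apply/asboolP/asboolP => h; apply: tcong_sym.
Qed.
Lemma tcongb_trans : transitive tcongb.
Proof.
by move=> t s u /asboolP h /asboolP h'; apply/asboolP; apply: tcong_trans h h'.
Qed.
Canonical tcong_equiv := EquivRel tcongb tcongb_refl tcongb_sym tcongb_trans.

Definition tens := {eq_quot tcong_equiv}.
HB.instance Definition _ := Choice.on tens.

Definition tcls (s : seq (X * Y)) : tens := \pi_tens s.
Definition pure (x : X) (y : Y) : tens := tcls [:: (x, y)].

Lemma tclsP s t : tcls s = tcls t <-> tcong s t.
Proof.
split; first by move=> /eqquotP /asboolP.
by move=> h; apply/eqquotP; apply/asboolP.
Qed.

Lemma tclsK t : tcls (repr t) = t.
Proof. exact: reprK. Qed.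

Lemma tcong_repr s : tcong (repr (tcls s)) s.
Proof. by apply/tclsP; rewrite tclsK. Qed.

Definition tadd (s t : tens) : tens := tcls (repr s ++ repr t).
Definition tscale (c : k) (s : tens) : tens :=
  tcls [seq (c *: p.1, p.2) | p <- repr s].
Definition topp (s : tens) : tens := tscale (- 1) s.

Lemma tadd_cls s t : tadd (tcls s) (tcls t) = tcls (s ++ t).
Proof. by apply/tclsP; apply: tcong_cat; apply: tcong_repr. Qed.

Lemma tcong_map_scale (c : k) s t : tcong s t ->
  tcong [seq (c *: p.1, p.2) | p <- s] [seq (c *: p.1, p.2) | p <- t].
Proof.
elim=> {s t}.
- by move=> s; apply: tcong_refl.
- by move=> s t _ h; apply: tcong_sym.
- by move=> s t u _ h _ h'; apply: tcong_trans h h'.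
- by move=> s s' t t' _ h _ h'; rewrite !map_cat; apply: tcong_cat.
- by move=> s t; rewrite !map_cat; apply: tcong_comm.
- by move=> y /=; rewrite scaler0; apply: tcong_zero.
- by move=> x x' y /=; rewrite scalerDr; apply: tcong_addl.
- by move=> x y y' /=; apply: tcong_addr.
- by move=> d x y /=; rewrite scalerA mulrC -scalerA; apply: tcong_scale.
- by move=> d x i y /=; rewrite !scalerA; apply: tcong_bal.
Qed.

Lemma tscale_cls c s :
  tscale c (tcls s) = tcls [seq (c *: p.1, p.2) | p <- s].
Proof. by apply/tclsP/tcong_map_scale/tcong_repr. Qed.

Lemma taddC : commutative tadd.
Proof. by move=> s t; apply/tclsP/tcong_comm. Qed.
Lemma taddA : associative tadd.
Proof.
move=> s t u; rewrite -[s]tclsK -[t]tclsK -[u]tclsK.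
by rewrite !tadd_cls catA.
Qed.
Lemma tadd0 : left_id (tcls [::]) tadd.
Proof. by move=> s; rewrite -[s]tclsK tadd_cls. Qed.

Lemma tpureDl x x' y : tcls [:: (x + x', y)] = tadd (pure x y) (pure x' y).
Proof. by rewrite tadd_cls; apply/tclsP/tcong_addl. Qed.

Lemma tcls_cons p s : tcls (p :: s) = tadd (pure p.1 p.2) (tcls s).
Proof. by case: p => x y; rewrite tadd_cls. Qed.

Lemma tpure0 y : pure 0 y = tcls [::].
Proof. by apply/tclsP/tcong_zero. Qed.

Lemma taddN : left_inverse (tcls [::]) topp tadd.
Proof.
move=> s; rewrite -[s]tclsK /topp tscale_cls.
elim: (repr s) => [|[x y] r IH]; first by rewrite tadd0.
rewrite /= !tcls_cons /= -taddA [X in tadd _ X]taddC -taddA.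
rewrite [X in tadd _ (tadd _ X)]taddC IH [X in tadd _ X]taddC tadd0.
by rewrite -tpureDl scaleN1r addNr -[LHS]/(pure 0 y) tpure0.
Qed.

HB.instance Definition _ :=
  GRing.isZmodule.Build tens taddA taddC tadd0 taddN.

Lemma taddE s t : s + t = tadd s t. Proof. by []. Qed.

Lemma tscaleA c d t : tscale c (tscale d t) = tscale (c * d) t.
Proof.
rewrite -[t]tclsK !tscale_cls -map_comp; congr tcls.
by apply: eq_map => p /=; rewrite scalerA.
Qed.
Lemma tscale1 : left_id 1 tscale.
Proof.
move=> t; rewrite -[t]tclsK tscale_cls; congr tcls.
by rewrite -[RHS]map_id; apply: eq_map => -[x y] /=; rewrite scale1r.
Qed.
Lemma tscaleDr : right_distributive tscale +%R.
Proof.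
move=> c s t; rewrite -[s]tclsK -[t]tclsK taddE tadd_cls !tscale_cls.
by rewrite taddE tadd_cls map_cat.
Qed.
Lemma tscaleDl t : {morph tscale^~ t : c d / c + d}.
Proof.
move=> c d; rewrite -[t]tclsK !tscale_cls /=.
elim: (repr t) => [|[x y] r IH] /=; first exact: (esym (tadd0 _)).
by rewrite !tcls_cons /= IH scalerDl /pure tpureDl -!taddE addrACA.
Qed.
HB.instance Definition _ :=
  GRing.Zmodule_isLmodule.Build k tens tscaleA tscale1 tscaleDr tscaleDl.

Lemma tscaleE c t : c *: t = tscale c t. Proof. by []. Qed.

Lemma tcls_sum s : tcls s = \sum_(p <- s) pure p.1 p.2.
Proof. by elim: s => [|p s IH]; rewrite ?big_nil ?big_cons -?IH ?tcls_cons. Qed.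

Lemma pureDl x x' y : pure (x + x') y = pure x y + pure x' y.
Proof. exact: tpureDl. Qed.
Lemma pureDr x y y' : pure x (y + y') = pure x y + pure x y'.
Proof. by rewrite taddE tadd_cls; apply/tclsP/tcong_addr. Qed.
Lemma pureZl c x y : pure (c *: x) y = c *: pure x y.
Proof. by rewrite tscaleE tscale_cls. Qed.
Lemma pureZr c x y : pure x (c *: y) = c *: pure x y.
Proof. by rewrite -pureZl; apply/esym/tclsP/tcong_scale. Qed.
Lemma pure_bal x i y : pure (ra x i) y = pure x (la i y).
Proof. by apply/tclsP; move: (tcong_bal 1 x i y); rewrite !scale1r. Qed.

Lemma tens_sum t : t = \sum_(p <- repr t) pure p.1 p.2.
Proof. by rewrite -tcls_sum tclsK. Qed.

Definition balanced (Z : lmodType k) (f : X -> Y -> Z) : Prop :=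
  [/\ forall y, linear (f^~ y), forall x, linear (f x)
    & forall x i y, f (ra x i) y = f x (la i y)].

(* The value on t of the map induced by f. It is computed on a representative
   of t, hence meaningful when f is balanced; see [tliftE]. *)
Definition tlift (Z : lmodType k) (f : X -> Y -> Z) (t : tens) : Z :=
  \sum_(p <- repr t) f p.1 p.2.

Section Lift.
Variables (Z : lmodType k) (f : X -> Y -> Z).
Hypothesis f_bal : balanced f.

Lemma balDl x x' y : f (x + x') y = f x y + f x' y.
Proof. by case: f_bal => h _ _; move: (h y 1 x x'); rewrite !scale1r. Qed.
Lemma balDr x y y' : f x (y + y') = f x y + f x y'.
Proof. by case: f_bal => _ h _; move: (h x 1 y y'); rewrite !scale1r. Qed.
Lemma bal0l y : f 0 y = 0.
Proof. by apply: (addrI (f 0 y)); rewrite -balDl !addr0. Qed.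
Lemma bal0r x : f x 0 = 0.
Proof. by apply: (addrI (f x 0)); rewrite -balDr !addr0. Qed.
Lemma balZl c x y : f (c *: x) y = c *: f x y.
Proof.
by case: f_bal => h _ _; move: (h y c x 0); rewrite !addr0 bal0l addr0.
Qed.
Lemma balZr c x y : f x (c *: y) = c *: f x y.
Proof.
by case: f_bal => _ h _; move: (h x c y 0); rewrite !addr0 bal0r addr0.
Qed.

Lemma tlift_cls s : tlift f (tcls s) = \sum_(p <- s) f p.1 p.2.
Proof.
rewrite /tlift; move: (tcong_repr s); move: (repr _) => r.
elim=> {r s} //.
- by move=> s t u _ -> _ ->.
- by move=> s s' t t' _ h _ h'; rewrite !big_cat /= h h'.
- by move=> s t; rewrite !big_cat /= addrC.
- by move=> y; rewrite big_seq1 big_nil bal0l.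
- by move=> x x' y; rewrite !big_cons big_nil !addr0 balDl.
- by move=> x y y'; rewrite !big_cons big_nil !addr0 balDr.
- by move=> c x y; rewrite !big_seq1 balZl balZr.
- by move=> c x i y; rewrite !big_seq1 !balZl; case: f_bal => _ _ ->.
Qed.

Lemma tliftE x y : tlift f (pure x y) = f x y.
Proof. by rewrite tlift_cls big_seq1. Qed.

Lemma tlift_linear : linear (tlift f).
Proof.
move=> c s t; rewrite -[s in LHS]tclsK -[t in LHS]tclsK.
rewrite tscaleE tscale_cls taddE tadd_cls.
rewrite tlift_cls big_cat big_map /= scaler_sumr; congr (_ + _).
by apply: eq_bigr => p _; rewrite balZl.
Qed.

Lemma tlift_sum J (r : seq J) (x : J -> X) (y : J -> Y) :
  tlift f (\sum_(j <- r) pure (x j) (y j)) = \sum_(j <- r) f (x j) (y j).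
Proof.
elim: r => [|j r IH]; first by rewrite !big_nil (tlift_cls [::]) big_nil.
rewrite !big_cons -IH; move: (tlift_linear 1 (pure (x j) (y j))
  (\sum_(j <- r) pure (x j) (y j))).
by rewrite !scale1r tliftE.
Qed.
End Lift.

Lemma balanced_pure : balanced pure.
Proof.
split=> [y c x x'|x c y y'|x i y]; last exact: pure_bal.
- by rewrite pureDl pureZl.
- by rewrite pureDr pureZr.
Qed.

Lemma tens_ind (P : tens -> Prop) :
  P 0 -> (forall x y, P (pure x y)) -> (forall s t, P s -> P t -> P (s + t)) ->
  forall t, P t.
Proof.
move=> P0 Pp PD t; rewrite [t]tens_sum.
by elim: (repr t) => [|p r IH]; rewrite ?big_nil ?big_cons //; apply: PD.
Qed.
End Tensor.

Section TensorLemmas.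
Variables (k : fieldType) (X Y Z : lmodType k) (I : Type).
Variables (ra : X -> I -> X) (la : I -> Y -> Y).
Variable f : X -> Y -> Z.
Hypothesis f_bal : balanced ra la f.
Local Notation tl := (tlift (ra := ra) (la := la) f).

Lemma tliftZ c s : tl (c *: s) = c *: tl s.
Proof.
have h0 : tl 0 = 0 by rewrite -[0 in LHS]/(tcls ra la [::]) tlift_cls ?big_nil.
by move: (tlift_linear f_bal c s 0); rewrite h0 !addr0.
Qed.
Lemma tlift0 : tl 0 = 0.
Proof. by rewrite -(scale0r 0) tliftZ scale0r. Qed.
Lemma tliftD s t : tl (s + t) = tl s + tl t.
Proof. by move: (tlift_linear f_bal 1 s t); rewrite !scale1r. Qed.
End TensorLemmas.

Section Extensions.
Variable k : fieldType.

Definition dual_bases (N M : algType k) (i : N -> M) (E : M -> N)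
    (s : seq (M * M)) : Prop :=
  forall m, \sum_(p <- s) i (E (m * p.1)) * p.2 = m /\
            \sum_(p <- s) p.1 * i (E (p.2 * m)) = m.

(* Strongly separable extension M/N of index lambda^-1, with chosen Frobenius
   homomorphism and dual bases. The ring map [incl] is automatically injective
   since E (incl n) = n; an N-bimodule map E is automatically k-linear. *)
Record ssext := SSExt {
  base : algType k;
  top : algType k;
  incl : {lrmorphism base -> top};
  cexp : {linear top -> base};
  dbas : seq (top * top);
  lam : k;
  cexp_bimod : forall n m n', cexp (incl n * m * incl n') = n * cexp m * n';
  dbasP : dual_bases incl cexp dbas;
  cexp1 : cexp 1 = 1;
  lam_neq0 : lam != 0;
  dbas_index : \sum_(p <- dbas) p.1 * p.2 = lam^-1%:A
}.

Section Jones.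
Variable F : ssext.
Local Notation N := (base F).
Local Notation M := (top F).
Local Notation i := (@incl F).
Local Notation E := (@cexp F).

Definition jones_top :=
  @tens k M M N (fun m n => m * i n) (fun n m => i n * m).
HB.instance Definition _ := GRing.Lmodule.on jones_top.

Definition jpure (m m' : M) : jones_top := pure _ _ m m'.

Definition jmul (t u : jones_top) : jones_top :=
  tlift (fun m m' => tlift (fun n n' => jpure (m * i (E (m' * n))) n') u) t.

Definition jone : jones_top := \sum_(p <- dbas F) jpure p.1 p.2.

Lemma cexpl n m : E (i n * m) = n * E m.
Proof. by rewrite -[i n * m]mulr1 -(rmorph1 i) cexp_bimod mulr1. Qed.
Lemma cexpr m n : E (m * i n) = E m * n.
Proof. by rewrite -[m * i n]mul1r mulrA -(rmorph1 i) cexp_bimod mul1r. Qed.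
Lemma dbasl m : \sum_(p <- dbas F) i (E (m * p.1)) * p.2 = m.
Proof. by case: (@dbasP F m). Qed.
Lemma dbasr m : \sum_(p <- dbas F) p.1 * i (E (p.2 * m)) = m.
Proof. by case: (@dbasP F m). Qed.

Lemma jpureDl x x' y : jpure (x + x') y = jpure x y + jpure x' y.
Proof. exact: pureDl. Qed.
Lemma jpureDr x y y' : jpure x (y + y') = jpure x y + jpure x y'.
Proof. exact: pureDr. Qed.
Lemma jpureZl c x y : jpure (c *: x) y = c *: jpure x y.
Proof. exact: pureZl. Qed.
Lemma jpureZr c x y : jpure x (c *: y) = c *: jpure x y.
Proof. exact: pureZr. Qed.
Lemma jpure_bal x n y : jpure (x * i n) y = jpure x (i n * y).
Proof. exact: (pure_bal (fun m n => m * i n) (fun n m => i n * m)). Qed.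
Lemma jpure0l y : jpure 0 y = 0.
Proof. by rewrite -(scale0r 0) jpureZl scale0r. Qed.
Lemma jpure0r x : jpure x 0 = 0.
Proof. by rewrite -(scale0r 0) jpureZr scale0r. Qed.
Lemma jpure_suml J (r : seq J) (x : J -> M) y :
  jpure (\sum_(j <- r) x j) y = \sum_(j <- r) jpure (x j) y.
Proof.
by elim: r => [|j r IH]; rewrite ?big_nil ?jpure0l // !big_cons jpureDl IH.
Qed.
Lemma jpure_sumr J (r : seq J) x (y : J -> M) :
  jpure x (\sum_(j <- r) y j) = \sum_(j <- r) jpure x (y j).
Proof.
by elim: r => [|j r IH]; rewrite ?big_nil ?jpure0r // !big_cons jpureDr IH.
Qed.

Lemma jinner_bal m m' :
  balanced (fun m n => m * i n) (fun n m => i n * m)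
    (fun n n' => jpure (m * i (E (m' * n))) n').
Proof.
split=> [y c x x'|x c y y'|x n y].
- rewrite mulrDr -scalerAr linearP linearP /=.
  by rewrite mulrDr -scalerAr jpureDl jpureZl.
- by rewrite jpureDr jpureZr.
- by rewrite mulrA cexpr rmorphM mulrA; exact: jpure_bal.
Qed.

Definition jmulp m m' (u : jones_top) : jones_top :=
  tlift (fun n n' => jpure (m * i (E (m' * n))) n') u.
Lemma jmulpE m m' n n' : jmulp m m' (jpure n n') = jpure (m * i (E (m' * n))) n'.
Proof. exact: tliftE (jinner_bal m m') _ _. Qed.
Lemma jmulpD m m' u v : jmulp m m' (u + v) = jmulp m m' u + jmulp m m' v.
Proof. exact: tliftD (jinner_bal m m') _ _. Qed.
Lemma jmulpZ m m' c u : jmulp m m' (c *: u) = c *: jmulp m m' u.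
Proof. exact: tliftZ (jinner_bal m m') _ _. Qed.
Lemma jmulp0 m m' : jmulp m m' 0 = 0.
Proof. by rewrite -(scale0r 0) jmulpZ !scale0r. Qed.

Lemma jtens_ind (P : jones_top -> Prop) :
  P 0 -> (forall x y, P (jpure x y)) -> (forall s t, P s -> P t -> P (s + t)) ->
  forall t, P t.
Proof. exact: tens_ind. Qed.

Lemma jmulp_bal u :
  balanced (fun m n => m * i n) (fun n m => i n * m) (fun m m' => jmulp m m' u).
Proof.
split=> [y c x x'|x c y y'|x n y].
- elim/jtens_ind: u => [|n n'|s t hs ht].
  + by rewrite !jmulp0 scaler0 addr0.
  + by rewrite !jmulpE mulrDl -scalerAl jpureDl jpureZl.
  + by rewrite !jmulpD hs ht scalerDr addrACA.
- elim/jtens_ind: u => [|n n'|s t hs ht].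
  + by rewrite !jmulp0 scaler0 addr0.
  + rewrite !jmulpE mulrDl -scalerAl linearP linearP /= mulrDr -scalerAr.
    by rewrite jpureDl jpureZl.
  + by rewrite !jmulpD hs ht scalerDr addrACA.
- elim/jtens_ind: u => [|m m'|s t hs ht].
  + by rewrite !jmulp0.
  + by rewrite !jmulpE -!mulrA cexpl rmorphM.
  + by rewrite !jmulpD hs ht.
Qed.

Lemma jmulE m m' n n' :
  jmul (jpure m m') (jpure n n') = jpure (m * i (E (m' * n))) n'.
Proof. by rewrite -jmulpE; exact: tliftE (jmulp_bal _) _ _. Qed.
Lemma jmulDl : left_distributive jmul +%R.
Proof. by move=> s t u; exact: tliftD (jmulp_bal u) _ _. Qed.
Lemma jmulZl c s u : jmul (c *: s) u = c *: jmul s u.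
Proof. exact: tliftZ (jmulp_bal u) _ _. Qed.
Lemma jmul0l u : jmul 0 u = 0.
Proof. by rewrite -(scale0r 0) jmulZl !scale0r. Qed.
Lemma jmulpuE m m' u : jmul (jpure m m') u = jmulp m m' u.
Proof. exact: tliftE (jmulp_bal u) _ _. Qed.
Lemma jmulDr : right_distributive jmul +%R.
Proof.
move=> s u v; elim/jtens_ind: s => [|m m'|s t hs ht].
- by rewrite !jmul0l addr0.
- by rewrite !jmulpuE jmulpD.
- by rewrite !jmulDl hs ht addrACA.
Qed.
Lemma jmulZr c s u : jmul s (c *: u) = c *: jmul s u.
Proof.
elim/jtens_ind: s => [|m m'|s t hs ht].
- by rewrite !jmul0l scaler0.
- by rewrite !jmulpuE jmulpZ.
- by rewrite !jmulDl hs ht scalerDr.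
Qed.
Lemma jmul0r u : jmul u 0 = 0.
Proof. by rewrite -(scale0r 0) jmulZr !scale0r. Qed.
Lemma jmulA : associative jmul.
Proof.
move=> s t u.
elim/jtens_ind: s => [|a a'|s s' h h']; first by rewrite !jmul0l.
  2: by rewrite !jmulDl h h'.
elim/jtens_ind: t => [|b b'|s s' h h']; first by rewrite ?(jmul0l, jmul0r).
  2: by rewrite !(jmulDl, jmulDr) h h'.
elim/jtens_ind: u => [|c c'|s s' h h']; first by rewrite !jmul0r.
  2: by rewrite !jmulDr h h'.
by rewrite !jmulE mulrA cexpr rmorphM mulrA.
Qed.
Lemma jmul_suml J (r : seq J) (x : J -> jones_top) y :
  jmul (\sum_(j <- r) x j) y = \sum_(j <- r) jmul (x j) y.
Proof.
by elim: r => [|j r IH]; rewrite ?big_nil ?jmul0l // !big_cons jmulDl IH.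
Qed.
Lemma jmul_sumr J (r : seq J) x (y : J -> jones_top) :
  jmul x (\sum_(j <- r) y j) = \sum_(j <- r) jmul x (y j).
Proof.
by elim: r => [|j r IH]; rewrite ?big_nil ?jmul0r // !big_cons jmulDr IH.
Qed.
Lemma jmul1l : left_id jone jmul.
Proof.
elim/jtens_ind => [|a a'|s s' h h']; first by rewrite jmul0r.
  rewrite /jone jmul_suml; under eq_bigr do rewrite jmulE.
  by rewrite -jpure_suml dbasr.
by rewrite jmulDr h h'.
Qed.
Lemma jmul1r : right_id jone jmul.
Proof.
elim/jtens_ind => [|a a'|s s' h h']; first by rewrite jmul0l.
  rewrite /jone jmul_sumr; under eq_bigr do rewrite jmulE jpure_bal.
  by rewrite -jpure_sumr dbasl.
by rewrite jmulDl h h'.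
Qed.

Lemma jexp_bal :
  balanced (fun m n => m * i n) (fun n m => i n * m)
    (fun m m' : M => lam F *: (m * m')).
Proof.
split=> [y c x x'|x c y y'|x n y].
- by rewrite mulrDl -scalerAl scalerDr !scalerA mulrC.
- by rewrite mulrDr -scalerAr scalerDr !scalerA mulrC.
- by rewrite mulrA.
Qed.
Definition jexp (t : jones_top) : M := tlift (fun m m' => lam F *: (m * m')) t.
Lemma jexpE m m' : jexp (jpure m m') = lam F *: (m * m').
Proof. exact: tliftE jexp_bal _ _. Qed.
Lemma jexp_linear : linear jexp.
Proof. exact: tlift_linear jexp_bal. Qed.
HB.instance Definition _ := GRing.isLinear.Build k jones_top M *:%R jexp jexp_linear.

Lemma jexp_jone : jexp jone = 1.
Proof.
rewrite /jone linear_sum /=; under eq_bigr do rewrite jexpE.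
by rewrite -scaler_sumr dbas_index scalerA divff ?scale1r ?lam_neq0.
Qed.
Lemma jone_neq0 : jone != 0.
Proof.
by apply/eqP => h; move: jexp_jone; rewrite h linear0 => /esym/eqP; rewrite oner_eq0.
Qed.

HB.instance Definition _ := GRing.Zmodule_isNzRing.Build jones_top
  jmulA jmul1l jmul1r jmulDl jmulDr jone_neq0.
Lemma jscalerAl (c : k) (s t : jones_top) : c *: (s * t) = c *: s * t.
Proof. by rewrite {2}/GRing.mul /= jmulZl. Qed.
Lemma jscalerAr (c : k) (s t : jones_top) : c *: (s * t) = s * (c *: t).
Proof. by rewrite {2}/GRing.mul /= jmulZr. Qed.
HB.instance Definition _ := GRing.Lmodule_isLalgebra.Build k jones_top jscalerAl.
HB.instance Definition _ := GRing.Lalgebra_isAlgebra.Build k jones_top jscalerAr.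

Lemma jpureM m m' n n' :
  jpure m m' * jpure n n' = jpure (m * i (E (m' * n))) n'.
Proof. exact: jmulE. Qed.

Definition jincl (m : M) : jones_top := \sum_(p <- dbas F) jpure (m * p.1) p.2.
Lemma jincl_linear : linear jincl.
Proof.
move=> c m m'; rewrite /jincl scaler_sumr -big_split /=.
by apply: eq_bigr => p _; rewrite mulrDl -scalerAl jpureDl jpureZl.
Qed.
Lemma jinclM_pure m n n' : jincl m * jpure n n' = jpure (m * n) n'.
Proof.
rewrite /jincl mulr_suml; under eq_bigr do rewrite jpureM -mulrA.
by rewrite -jpure_suml -mulr_sumr dbasr.
Qed.
Lemma jpureM_incl m n n' : jpure n n' * jincl m = jpure n (n' * m).
Proof.
rewrite /jincl mulr_sumr; under eq_bigr do rewrite jpureM mulrA jpure_bal.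
by rewrite -jpure_sumr dbasl.
Qed.
Lemma jincl_monoid : monoid_morphism jincl.
Proof.
split; first by rewrite /jincl; under eq_bigr do rewrite mul1r.
move=> m m'; rewrite [jincl m' in RHS]/jincl mulr_sumr.
by apply: eq_bigr => p _; rewrite jinclM_pure mulrA.
Qed.
HB.instance Definition _ :=
  GRing.isLinear.Build k M jones_top *:%R jincl jincl_linear.
HB.instance Definition _ :=
  GRing.isMonoidMorphism.Build M jones_top jincl jincl_monoid.

Definition jdbas : seq (jones_top * jones_top) :=
  [seq ((lam F)^-1 *: jpure p.1 1, jpure 1 p.2) | p <- dbas F].

Lemma jexp_bimod n t n' : jexp (jincl n * t * jincl n') = n * jexp t * n'.
Proof.
elim/jtens_ind: t => [|a a'|s s' h h'].
- by rewrite mulr0 mul0r linear0 mulr0 mul0r.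
- by rewrite jinclM_pure jpureM_incl !jexpE -scalerAr -scalerAl !mulrA.
- by rewrite mulrDr mulrDl !linearD /= h h' mulrDr mulrDl.
Qed.

Lemma jdbasP : dual_bases jincl jexp jdbas.
Proof.
have lr c : lam F *: ((lam F)^-1 *: c) = c :> M.
  by rewrite scalerA divff ?scale1r ?lam_neq0.
move=> t; rewrite /jdbas !big_map /=; split.
- elim/jtens_ind: t => [|a a'|s s' h h'].
  + by under eq_bigr do rewrite mul0r !linear0 mul0r; rewrite big1.
  + under eq_bigr do rewrite -scalerAr jpureM linearZ /= jexpE mulr1 scalerA
      mulVf ?lam_neq0 // scale1r jinclM_pure mulr1 jpure_bal.
    by rewrite -jpure_sumr dbasl.
  + by rewrite -{2}h -{2}h' -big_split; apply: eq_bigr => p _;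
      rewrite mulrDl linearD linearD mulrDl.
- elim/jtens_ind: t => [|a a'|s s' h h'].
  + by under eq_bigr do rewrite mulr0 !linear0 mulr0; rewrite big1.
  + under eq_bigr do rewrite jpureM mul1r jexpE -scalerAl linearZ /= -scalerAr
      scalerA mulVf ?lam_neq0 // scale1r jpureM_incl mul1r -jpure_bal.
    by rewrite -jpure_suml dbasr.
  + by rewrite -{2}h -{2}h' -big_split; apply: eq_bigr => p _;
      rewrite mulrDr linearD linearD mulrDr.
Qed.

Lemma jdbas_index : \sum_(p <- jdbas) p.1 * p.2 = (lam F)^-1%:A.
Proof.
rewrite /jdbas big_map /=.
under eq_bigr do rewrite -scalerAl jpureM mulr1 cexp1 rmorph1 mulr1.
by rewrite -scaler_sumr.
Qed.

(* The basic construction: M_1 = M (x)_N M over M, with E_M (m e_1 m') =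
   lambda m m' and the same index. *)
Definition jones : ssext :=
  @SSExt M jones_top jincl jexp jdbas (lam F)
    jexp_bimod jdbasP jexp_jone (lam_neq0 F) jdbas_index.

Definition jproj : top jones := jpure 1 1.
End Jones.
End Extensions.

Section Algebra.
Variable k : fieldType.

Definition tensk (X Y : lmodType k) : lmodType k :=
  @tens k X Y k (fun x c => c *: x) (fun c y => c *: y).
Definition purek (X Y : lmodType k) (x : X) (y : Y) : tensk X Y := pure _ _ x y.

Definition is_trace (R : algType k) (t : R -> k) : Prop :=
  forall x y, t (x * y) = t (y * x).

(* The centralizer in S of the image of f. *)
Section Centralizer.
Variables (R : Type) (S : algType k) (f : R -> S).

Definition centralizer : {pred S} :=
  fun x => `[< forall r, f r * x = x * f r >].

Lemma centralizerP x : reflect (forall r, f r * x = x * f r) (x \in centralizer).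
Proof. exact: asboolP. Qed.

Lemma centralizer_subalg : subalg_closed centralizer.
Proof.
split.
- by apply/centralizerP => r; rewrite mulr1 mul1r.
- move=> c x y /centralizerP hx /centralizerP hy; apply/centralizerP => r.
  by rewrite mulrDr mulrDl hy -scalerAr hx scalerAl.
- move=> x y /centralizerP hx /centralizerP hy; apply/centralizerP => r.
  by rewrite mulrA hx -mulrA hy mulrA.
Qed.
HB.instance Definition _ :=
  GRing.isSubalgClosed.Build k S centralizer centralizer_subalg.

Definition cent := {x : S | x \in centralizer}.
HB.instance Definition _ := SubChoice.on cent.
HB.instance Definition _ := [SubChoice_isSubAlgebra of cent by <:].
End Centralizer.

Definition sep_element (R : algType k) (e : tensk R R) : Prop :=
  (forall r, tlift (fun x y => purek (r * x) y) e =
             tlift (fun x y => purek x (y * r)) e)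
  /\ tlift (fun x y => x * y) e = 1.

Definition sym_sep_element (R : algType k) (e : tensk R R) : Prop :=
  sep_element e /\ tlift (fun x y => purek y x) e = e.

Definition kanzaki_separable (R : algType k) : Prop :=
  exists e : tensk R R, sym_sep_element e.

(* The smash product X # H, which depends only on the comultiplication and
   counit of H and on the action of H on X: the space X (x)_{H_t} H, where X is
   a right H_t-module by x.z = x (z.1), and the property that characterizes its
   algebra structure ([smash_algebra_uniq]). *)
Section Smash.
Variables (H X : algType k) (Delta : H -> tensk H H) (eps : H -> k).
Variable act : H -> X -> X.

Definition eps_t (h : H) : H :=
  tlift (fun p q => eps (p * h) *: q) (Delta 1).

Definition target_subalg := {z : H | exists h, z = eps_t h}.

Definition smash : lmodType k :=
  @tens k X H target_subalg
    (fun x z => x * act (sval z) 1) (fun z h => sval z * h).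

Definition smash_pure (x : X) (h : H) : smash := pure _ _ x h.

Definition smash_algebra (mul : smash -> smash -> smash) : Prop :=
  [/\ forall p, linear (mul p), forall q, linear (mul^~ q), associative mul,
      left_id (smash_pure 1 1) mul & right_id (smash_pure 1 1) mul]
  /\ forall x h y g, mul (smash_pure x h) (smash_pure y g) =
       tlift (fun p q => smash_pure (x * act p y) (q * g)) (Delta h).

Lemma smash_algebra_uniq mul mul' :
  smash_algebra mul -> smash_algebra mul' -> mul =2 mul'.
Proof.
move=> [[l r _ _ _] e] [[l' r' _ _ _] e'] p q.
have lin0 (f : smash -> smash) : linear f -> f 0 = 0.
  by move=> h; move: (h (-1) 0 0); rewrite scaler0 addr0 scaleN1r addNr.
have linD (f : smash -> smash) : linear f -> {morph f : s t / s + t}.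
  by move=> h s t; move: (h 1 s t); rewrite !scale1r.
elim/tens_ind: p => [|x h|s s' hs hs'].
- by rewrite (lin0 _ (r q)) (lin0 _ (r' q)).
- elim/tens_ind: q => [|y g|t t' ht ht'].
  + by rewrite (lin0 _ (l _)) (lin0 _ (l' _)).
  + by rewrite [LHS]e [RHS]e'.
  + by rewrite (linD _ (l _)) (linD _ (l' _)) ht ht'.
- by rewrite (linD _ (r q)) (linD _ (r' q)) hs hs'.
Qed.
End Smash.
End Algebra.

Section Tower.
Variables (k : fieldType) (F : ssext k) (T : {scalar base F}).

(* F = M/N, F1 = M1/M, F2 = M2/M1. *)
Definition F1 : ssext k := jones F.
Definition F2 : ssext k := jones F1.

Definition M0 : algType k := top F.
Definition M1 : algType k := top F1.
Definition M2 : algType k := top F2.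

Definition i1 : {lrmorphism M0 -> M1} := incl F1.
Definition i2 : {lrmorphism M1 -> M2} := incl F2.
Definition E1 : {linear M1 -> M0} := cexp F1.
Definition E2 : {linear M2 -> M1} := cexp F2.
Definition e1 : M1 := jproj F.
Definition e2 : M2 := jproj F1.

Definition T0 (m : M0) : k := T (cexp F m).
Definition T1 (x : M1) : k := T0 (E1 x).
Definition T2 (x : M2) : k := T1 (E2 x).

Definition U : algType k := cent (incl F).
Definition V : algType k := cent i1.
Definition A : algType k := cent (fun n : base F => i1 (incl F n)).
Definition B : algType k := cent (fun m : M0 => i2 (i1 m)).

Definition symmetric_markov : Prop :=
  [/\ is_trace T, T 1 = 1, is_trace T0
    & forall (u : U) (x : M0), cexp F (val u * x) = cexp F (x * val u)].

Definition phi (u : U) : M1 :=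
  \sum_(p <- dbas F) i1 (p.1 * val u) * e1 * i1 p.2.

Definition symmetric_product : Prop :=
  \sum_(p <- dbas F) p.2 * p.1 = (lam F)^-1%:A.

Definition weakly_irreducible : Prop :=
  kanzaki_separable U /\
  forall u : U, (forall u' : U, T0 (val u * val u') = 0) -> u = 0.

Definition depth2 : Prop :=
  (exists s : seq (A * A), dual_bases i1 E1 [seq (val p.1, val p.2) | p <- s]) /\
  (exists s : seq (B * B), dual_bases i2 E2 [seq (val p.1, val p.2) | p <- s]).

(* f^(1) T(f^(2)), T denoting the restriction of T2. *)
Definition slice_T (f : tensk V V) : V :=
  tlift (fun x y => T2 (i2 (val y)) *: x) f.

Definition pairing (w : V) (a : A) (b : B) : k :=
  lam F ^- 2 * T2 (i2 (val a) * e2 * i2 e1 * i2 (val w) * val b).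
Definition pairing' (w : V) (a : A) (b : B) : k :=
  lam F ^- 2 * T2 (val b * i2 e1 * e2 * i2 (val w) * i2 (val a)).

Definition is_comult (w : V) (Delta : A -> tensk A A) : Prop :=
  forall a b b',
    tlift (Z := k^o) (fun p q => pairing w p b * pairing w q b') (Delta a) =
    pairing w a (b * b').

Definition counit (w : V) (a : A) : k := pairing w a 1.

(* a |> m = a_(1) m S(a_(2)), an identity in M1. *)
Definition is_adj_action (Delta : A -> tensk A A) (S : A -> A)
    (act : A -> M0 -> M0) : Prop :=
  forall a m, i1 (act a m) =
    tlift (fun p q => val p * i1 m * val (S q)) (Delta a).
End Tower.

(* Main.v *)
Require Import Defs.
From HB Require Import structures.
From mathcomp Require Import all_boot all_order all_algebra.

(** Write j for the inclusion of M in M_1, e for e_1, E_M for the conditional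
    expectation M_1 -> M and x_i, y_i for the dual bases of E. Everything rests
    on translating the structure of A, defined through the tower up to M_2, into
    formulas that live in M_1.

    The translation is possible because the pairing of A with B is the trace
    form T_1 of A in disguise: every c in A has a companion b in B with
    <a, b> = T_1(a c) ([pairing_Brep]), and T_1 is non-degenerate on A
    ([T1_nondeg]), since depth two expands an element of A along dual bases with
    coefficients in U, where T_0 is non-degenerate. Comultiplication and
    antipode are thereby determined by scalar products in A, and come out as

      a_(1) T_1(a_(2) c) = w^-1 x_i e E_M(c y_i a)           ([comult_T1])
      S(a) = w^-1 tau(a) w                                   ([antipodeE])

    where tau(a) acts on the right of M as a acts on the left:
    E_M(e m tau(a)) = E_M(a m e). Expanding the second tensor factor along dual
    bases of T_1 on A gives the three facts that the isomorphism needs.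

    - The action is the standard one, a |> m = lam^-1 E_M(a m e) ([actE]).
    - The target counital map is h |-> lam^-1 E_M(h e) ([eps_tE]); hence the
      target subalgebra is the copy of U in A, and z |> 1 = z for z in it.
    - (a_(1) |> m) a_(2) = a m in M_1 ([act_cancel]). This is what makes
      m # a |-> m a multiplicative. It uses that E E_M(c x) = E E_M(x c) for c
      in A, which non-degeneracy of T_1 on A forces ([frobenius_symmetric]).

    Finally M (x)_U A -> M_1, m (x) a |-> m a, is bijective by depth two alone:
    if a_i, b_i in A are dual bases of E_M then x |-> E_M(x a_i) # b_i is the
    inverse, because E_M(a a_i) lies in U and moves across the tensor sign. The
    smash product structure is transported from M_1 along this bijection. *)

Set Implicit Arguments.
Unset Strict Implicit.
Unset Printing Implicit Defensive.
Import GRing.Theory.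
Local Open Scope ring_scope.

(** * The basic construction *)

Section BasicConstruction.
Variables (k : fieldType) (F : ssext k).
Local Notation N := (base F).
Local Notation M := (top F).
Local Notation i := (@incl k F).
Local Notation E := (@cexp k F).
Local Notation j := (i1 F).
Local Notation EM := (E1 F).
Local Notation e := (e1 F).
Local Notation lam := (lam F).

Local Notation jp := (@jpure k F : M -> M -> M1 F).
Lemma i1M_jpure m n n' : j m * jp n n' = jp (m * n) n'.
Proof. exact: jinclM_pure. Qed.

Lemma jpureM_i1 m n n' : jp n n' * j m = jp n (n' * m).
Proof. exact: jpureM_incl. Qed.

Lemma jpure_e1 m m' : jp m m' = j m * e * j m'.
Proof. by rewrite i1M_jpure jpureM_i1 mulr1 mul1r. Qed.

Lemma e1_base n : j (i n) * e = e * j (i n).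
Proof.
by rewrite i1M_jpure jpureM_i1 mulr1 mul1r -[i n in LHS]mul1r jpure_bal mulr1.
Qed.

Lemma e1_mid m : e * j m * e = j (i (E m)) * e.
Proof.
rewrite i1M_jpure jpureM_i1 mulr1 mul1r.
by have := jpureM (F := F) 1 m 1 1; rewrite mul1r mulr1.
Qed.

Lemma e1_midr m : e * j m * e = e * j (i (E m)).
Proof. by rewrite e1_mid e1_base. Qed.

Lemma E1_mulA m x m' : EM (j m * x * j m') = m * EM x * m'.
Proof. exact: (jexp_bimod (F := F)). Qed.

Lemma E1_mull m x : EM (j m * x) = m * EM x.
Proof. by have := E1_mulA m x 1; rewrite rmorph1 !mulr1. Qed.

Lemma E1_mulr x m : EM (x * j m) = EM x * m.
Proof. by have := E1_mulA 1 x m; rewrite rmorph1 !mul1r. Qed.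

Lemma E1_id m : EM (j m) = m.
Proof. by rewrite -[j m]mulr1 E1_mull [EM 1](jexp_jone F) mulr1. Qed.

Lemma E1_e1 : EM e = lam%:A.
Proof.
by transitivity (lam *: (1 * 1 : M)); [exact: jexpE | rewrite mulr1].
Qed.

Lemma E1_pure m m' : EM (j m * e * j m') = lam *: (m * m').
Proof. by rewrite E1_mulA E1_e1 -scalerAr mulr1 -scalerAl. Qed.

Lemma sum_e1 : \sum_(p <- dbas F) j p.1 * e * j p.2 = 1.
Proof. by under eq_bigr do rewrite -jpure_e1. Qed.

Lemma M1_ind (P : M1 F -> Prop) :
  P 0 -> (forall m m', P (j m * e * j m')) ->
  (forall x y, P x -> P y -> P (x + y)) -> forall x, P x.
Proof.
move=> P0 Pp PD; apply: jtens_ind => // m m'.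
by have := Pp m m'; rewrite -jpure_e1.
Qed.

Lemma lamK (V : lmodType k) (x : V) : lam^-1 *: (lam *: x) = x.
Proof. by rewrite scalerA mulVf ?scale1r ?lam_neq0. Qed.

Lemma lamVK (V : lmodType k) (x : V) : lam *: (lam^-1 *: x) = x.
Proof. by rewrite scalerA divff ?scale1r ?lam_neq0. Qed.

(** Elements of M_1 e are determined by their expectation; on either side of e
    this turns products in M_1 into elements of M. *)
Lemma push_e1 x : x * e = lam^-1 *: (j (EM (x * e)) * e).
Proof.
elim/M1_ind: x => [|m m'|x y hx hy].
- by rewrite mul0r !linear0 mul0r scaler0.
- rewrite -!mulrA [e * (_ * _)]mulrA e1_mid mulrA -rmorphM.
  by rewrite E1_mull E1_e1 -scalerAr mulr1 linearZ -scalerAl lamK.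
- by rewrite mulrDl {1}hx {1}hy !linearD /= mulrDl -scalerDr.
Qed.

Lemma e1_push x : e * x = lam^-1 *: (e * j (EM (e * x))).
Proof.
elim/M1_ind: x => [|m m'|x y hx hy].
- by rewrite mulr0 !linear0 mulr0 scaler0.
- rewrite !mulrA e1_midr -mulrA -rmorphM.
  by rewrite E1_mulr E1_e1 -scalerAl mul1r linearZ -scalerAr lamK.
- by rewrite mulrDr {1}hx {1}hy !linearD /= mulrDr -scalerDr.
Qed.

Lemma e1_inj m m' : j m * e = j m' * e -> m = m'.
Proof.
move/(congr1 EM); rewrite !E1_mull E1_e1 -!scalerAr !mulr1.
by move/(congr1 (fun x => lam^-1 *: x)); rewrite !lamK.
Qed.

(** T E E_M is a trace because (a e b)(c e d) has trace lam T(E(b c) E(d a)),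
    which is symmetric in the two factors. *)
Lemma trace_tower (T : {scalar N}) :
  is_trace T -> is_trace (fun m => T (E m)) -> is_trace (fun x => T (E (EM x))).
Proof.
move=> trT trM x y; elim/M1_ind: x => [|m m'|x x' hx hx'].
- by rewrite mul0r mulr0.
- elim/M1_ind: y => [|n n'|y y' hy hy'].
  + by rewrite mul0r mulr0.
  + have h (a b c d : M) :
        T (E (EM (j a * e * j b * (j c * e * j d)))) =
        lam * T (E (b * c) * E (d * a)).
      have -> : j a * e * j b * (j c * e * j d) =
                j (a * i (E (b * c))) * e * j d.
        rewrite !mulrA -[j a * e * j b * j c]mulrA -rmorphM -!mulrA.
        rewrite [e * (j (b * c) * _)]mulrA [e * j (b * c) * _]mulrA e1_mid.
        by rewrite rmorphM !mulrA.
      rewrite E1_pure !linearZ /=; congr (_ * _).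
      by rewrite (trM (a * _)) mulrA cexpr trT.
    by rewrite !h trT.
  + by rewrite mulrDr mulrDl !linearD /= hy hy'.
- by rewrite mulrDr mulrDl !linearD /= hx hx'.
Qed.

(** The element x_i (x) y_i of M (x)_N M commutes with M, and the middle factor
    c respects the tensor product over N. *)
Lemma dbas_central (R : algType k) (h : {rmorphism M -> R}) (c : R) :
  (forall n, h (i n) * c = c * h (i n)) ->
  forall m, h m * (\sum_(p <- dbas F) h p.1 * c * h p.2) =
            (\sum_(p <- dbas F) h p.1 * c * h p.2) * h m.
Proof.
move=> hc m; rewrite mulr_sumr mulr_suml.
under eq_bigr => p _.
  rewrite !mulrA -rmorphM -[m * p.1](dbasr (F := F)) rmorph_sum !mulr_suml.
  under eq_bigr do rewrite rmorphM -[h _ * _ * c]mulrA hc mulrA -mulrA -rmorphM.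
  over.
rewrite exchange_big /=; apply: eq_bigr => q _.
rewrite -mulr_sumr -rmorph_sum -[RHS]mulrA -rmorphM; congr (_ * h _).
rewrite -[RHS](dbasl (F := F)); apply: eq_bigr => p _.
by rewrite !mulrA.
Qed.
End BasicConstruction.

(** * The next step of the tower *)

Section Jones2.
Variables (k : fieldType) (F : ssext k).
Local Notation lam := (lam F).

Lemma dbas1l : \sum_(p <- dbas F) incl F (cexp F p.1) * p.2 = 1.
Proof.
by rewrite -[RHS](dbasl (F := F)); under [RHS]eq_bigr do rewrite mul1r.
Qed.

Lemma dbas1r : \sum_(p <- dbas F) p.1 * incl F (cexp F p.2) = 1.
Proof.
by rewrite -[RHS](dbasr (F := F)); under [RHS]eq_bigr do rewrite mulr1.
Qed.

Lemma dbas_F1l x : \sum_(p <- dbas (F1 F)) i1 F (E1 F (x * p.1)) * p.2 = x.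
Proof. exact: (dbasl (F := F1 F)). Qed.
Lemma dbas_F1r x : \sum_(p <- dbas (F1 F)) p.1 * i1 F (E1 F (p.2 * x)) = x.
Proof. exact: (dbasr (F := F1 F)). Qed.

Lemma e2_M x : e2 F * i2 F (i1 F x) = i2 F (i1 F x) * e2 F.
Proof. by have := e1_base (F := F1 F) x. Qed.

Lemma e2_mid x : e2 F * i2 F x * e2 F = i2 F (i1 F (E1 F x)) * e2 F.
Proof. exact: (e1_mid (F := F1 F)). Qed.

Lemma e2_push x : x * e2 F = lam^-1 *: (i2 F (E2 F (x * e2 F)) * e2 F).
Proof. exact: (push_e1 (F := F1 F)). Qed.

Lemma E2_mulA a x b : E2 F (i2 F a * x * i2 F b) = a * E2 F x * b.
Proof. exact: (E1_mulA (F := F1 F)). Qed.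
Lemma E2_mull a x : E2 F (i2 F a * x) = a * E2 F x.
Proof. exact: (E1_mull (F := F1 F)). Qed.
Lemma E2_mulr a x : E2 F (x * i2 F a) = E2 F x * a.
Proof. exact: (E1_mulr (F := F1 F)). Qed.
Lemma E2_id a : E2 F (i2 F a) = a.
Proof. exact: (E1_id (F := F1 F)). Qed.
Lemma E2_e2 : E2 F (e2 F) = lam%:A.
Proof. exact: (E1_e1 (F1 F)). Qed.

Lemma i1M x y : i1 F (x * y) = i1 F x * i1 F y. Proof. exact: rmorphM. Qed.
Lemma i2M x y : i2 F (x * y) = i2 F x * i2 F y. Proof. exact: rmorphM. Qed.
Lemma i1Z c x : i1 F (c *: x) = c *: i1 F x. Proof. exact: linearZZ. Qed.
Lemma i1_sum I (r : seq I) (h : I -> M0 F) :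
  i1 F (\sum_(p <- r) h p) = \sum_(p <- r) i1 F (h p).
Proof. exact: raddf_sum. Qed.
Lemma i2_sum I (r : seq I) (h : I -> M1 F) :
  i2 F (\sum_(p <- r) h p) = \sum_(p <- r) i2 F (h p).
Proof. exact: raddf_sum. Qed.
Lemma E1_sum I (r : seq I) (h : I -> M1 F) :
  E1 F (\sum_(p <- r) h p) = \sum_(p <- r) E1 F (h p).
Proof. exact: raddf_sum. Qed.
Lemma E2_sum I (r : seq I) (h : I -> M2 F) :
  E2 F (\sum_(p <- r) h p) = \sum_(p <- r) E2 F (h p).
Proof. exact: raddf_sum. Qed.
Lemma i2Z c x : i2 F (c *: x) = c *: i2 F x. Proof. exact: linearZZ. Qed.
Lemma E1Z c x : E1 F (c *: x) = c *: E1 F x. Proof. exact: linearZZ. Qed.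

(** One Temperley-Lieb relation; the other is a case of [e2_mid]. *)
Lemma e1e2e1 : i2 F (e1 F) * e2 F * i2 F (e1 F) = lam *: i2 F (e1 F).
Proof.
rewrite -[i2 F (e1 F) in RHS]mulr1.
have /esym -> : \sum_(p <- dbas F)
   i2 F (lam^-1 *: (i1 F p.1 * e1 F)) * e2 F * i2 F (e1 F * i1 F p.2) = 1.
  rewrite -[RHS](sum_e1 (F1 F)) [RHS]big_map; apply: eq_bigr => p _ /=.
  by congr (i2 F (_ *: _) * _ * i2 F _); rewrite jpure_e1 rmorph1 ?mulr1 ?mul1r.
rewrite mulr_sumr.
under eq_bigr do rewrite !mulrA -i2M -scalerAr mulrA e1_midr i2Z -!scalerAl.
rewrite -scaler_sumr lamVK.
under eq_bigr do rewrite i2M -[i2 F _ * _ * e2 F]mulrA -e2_M -!mulrA -i2M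
  [i1 F _ * (_ * _)]mulrA e1_base -[e1 F * _ * _]mulrA -i1M.
rewrite -!mulr_sumr -!rmorph_sum -mulr_sumr -rmorph_sum dbas1l.
by rewrite rmorph1 mulr1 mulrA.
Qed.
End Jones2.

(** * Frobenius homomorphisms commuting with the centralizer *)

Section FrobeniusSymmetric.
Variables (k : fieldType) (N R : algType k) (i : {lrmorphism N -> R}).
Variables (G : {linear R -> N}) (s : seq (R * R)) (T : {scalar N}).
Hypothesis GP : forall n x n', G (i n * x * i n') = n * G x * n'.
Hypothesis sP : dual_bases i G s.
Hypothesis trT : is_trace (fun x => T (G x)).
Hypothesis ndT : forall c, c \in centralizer i ->
  (forall d, d \in centralizer i -> T (G (c * d)) = 0) -> c = 0.

(** There is always some c' in the centralizer with G(x c') = G(c x) for all x,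
    the Nakayama image of c. Since T G is a trace, c and c' have the same scalar
    products with the centralizer, and non-degeneracy there gives c' = c. *)
Lemma frobenius_symmetric c x : c \in centralizer i -> G (c * x) = G (x * c).
Proof.
move=> /[dup] cA /centralizerP cC.
have Gl n y : G (i n * y) = n * G y by have := GP n y 1; rewrite rmorph1 !mulr1.
have Gr n y : G (y * i n) = G y * n by have := GP 1 y n; rewrite rmorph1 !mul1r.
pose c' := \sum_(p <- s) p.1 * i (G (c * p.2)).
have Gc' y : G (y * c') = G (c * y).
  rewrite /c' mulr_sumr -[y in RHS](sP y).1 mulr_sumr !linear_sum /=.
  by apply: eq_bigr => p _; rewrite mulrA Gr mulrA -cC -mulrA Gl.
have G_inj y z : (forall x, G (x * y) = G (x * z)) -> y = z.
  move=> h; rewrite -[y](sP y).2 -[z](sP z).2.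
  by apply: eq_bigr => p _; rewrite h.
have c'C : c' \in centralizer i.
  apply/centralizerP => n; apply: G_inj => y.
  by rewrite !mulrA Gc' Gr Gc' mulrA Gr.
suff /subr0_eq cc' : c - c' = 0 by rewrite -Gc' -cc'.
apply: ndT => [|d _]; first by apply: rpredB.
by rewrite mulrBl !linearB /= -(Gc' d) [T (G (c' * d))]trT subrr.
Qed.
End FrobeniusSymmetric.

(* From here on the maps and projections of the tower are used only through the
   identities above, never through their construction from tensor classes. *)
#[global] Opaque i1 i2 E1 E2 e1 e2.

HB.instance Definition _ (k : fieldType) (F : ssext k) (T : {scalar base F}) :=
  GRing.Linear.copy (T0 T) (T \o cexp F).
HB.instance Definition _ (k : fieldType) (F : ssext k) (T : {scalar base F}) :=
  GRing.Linear.copy (T1 T) (T0 T \o E1 F).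

(** * Centralizers and traces of the tower *)

Section Centralizers.
Variables (k : fieldType) (F : ssext k).

Lemma valA_comm (a : A F) n :
  i1 F (incl F n) * val a = val a * i1 F (incl F n).
Proof. exact: (centralizerP _ _ (valP a)). Qed.

Lemma valV_comm (v : V F) m : i1 F m * val v = val v * i1 F m.
Proof. exact: (centralizerP _ _ (valP v)). Qed.

Lemma valU_comm (u : U F) n : incl F n * val u = val u * incl F n.
Proof. exact: (centralizerP _ _ (valP u)). Qed.

Lemma valB_comm (b : B F) m : i2 F (i1 F m) * val b = val b * i2 F (i1 F m).
Proof. exact: (centralizerP _ _ (valP b)). Qed.

Lemma valVM (x y : V F) : val (x * y) = val x * val y. Proof. by []. Qed.
Lemma valAM (x y : A F) : val (x * y) = val x * val y. Proof. by []. Qed.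
Lemma valAD (x y : A F) : val (x + y) = val x + val y. Proof. by []. Qed.
Lemma valAZ c (x : A F) : val (c *: x) = c *: val x. Proof. by []. Qed.
Lemma valA_sum I (r : seq I) (h : I -> A F) :
  val (\sum_(p <- r) h p) = \sum_(p <- r) val (h p).
Proof. exact: raddf_sum. Qed.

Lemma i1_cent u : u \in centralizer (incl F) ->
  i1 F u \in centralizer (fun n : base F => i1 F (incl F n)).
Proof.
by move=> /centralizerP uU; apply/centralizerP => n; rewrite -!i1M uU.
Qed.

Lemma E1_cent a : a \in centralizer (fun n : base F => i1 F (incl F n)) ->
  E1 F a \in centralizer (incl F).
Proof.
move=> /centralizerP aA; apply/centralizerP => n.
by rewrite -E1_mull aA E1_mulr.
Qed.

Lemma e1_cent : e1 F \in centralizer (fun n : base F => i1 F (incl F n)).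
Proof. by apply/centralizerP => n; rewrite e1_base. Qed.

Lemma V_cent (v : V F) :
  val v \in centralizer (fun n : base F => i1 F (incl F n)).
Proof. by apply/centralizerP => n; rewrite valV_comm. Qed.

End Centralizers.

Section Markov.
Variables (k : fieldType) (F : ssext k) (T : {scalar base F}).
Hypothesis hMarkov : symmetric_markov T.
Local Notation N := (base F).
Local Notation M := (top F).
Local Notation i := (@incl k F).
Local Notation E := (@cexp k F).
Local Notation j := (i1 F).
Local Notation EM := (E1 F).
Local Notation e := (e1 F).
Local Notation lam := (lam F).
Local Notation T0 := (T0 T).
Local Notation T1 := (T1 T).
Local Notation T2 := (T2 T).

Lemma T0C x y : T0 (x * y) = T0 (y * x).
Proof. by case: hMarkov => _ _ h _; apply: h. Qed.

Lemma T1C x y : T1 (x * y) = T1 (y * x).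
Proof. by case: hMarkov => h _ h' _; apply: (trace_tower h h'). Qed.

Lemma T2C x y : T2 (x * y) = T2 (y * x).
Proof. exact: (trace_tower (F := F1 F) (T := T0) T0C T1C x y). Qed.

Lemma T1E x : T1 x = T0 (EM x). Proof. by []. Qed.

Lemma T0Z c x : T0 (c *: x) = c * T0 x.
Proof. by rewrite /Defs.T0 !linearZ. Qed.

Lemma T1Z c x : T1 (c *: x) = c * T1 x.
Proof. by rewrite /Defs.T1 /Defs.T0 !linearZ. Qed.

Lemma T0_sum I (r : seq I) (h : I -> M) :
  T0 (\sum_(p <- r) h p) = \sum_(p <- r) T0 (h p).
Proof. exact: raddf_sum. Qed.

Lemma T1_sum I (r : seq I) (h : I -> M1 F) :
  T1 (\sum_(p <- r) h p) = \sum_(p <- r) T1 (h p).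
Proof. exact: raddf_sum. Qed.

Lemma T1B x y : T1 (x - y) = T1 x - T1 y.
Proof. exact: raddfB. Qed.

Lemma T1_mull m x : T1 (j m * x) = T0 (m * EM x).
Proof. by rewrite T1E E1_mull. Qed.

Lemma T1_mulr x m : T1 (x * j m) = T0 (EM x * m).
Proof. by rewrite T1E E1_mulr. Qed.

Lemma T1_pure m m' : T1 (j m * e * j m') = lam * T0 (m * m').
Proof. by rewrite T1E E1_pure T0Z. Qed.

Variable s : seq (A F * A F).
Hypothesis sP : dual_bases j EM [seq (val p.1, val p.2) | p <- s].
Hypothesis ndU :
  forall u : U F, (forall u' : U F, T0 (val u * val u') = 0) -> u = 0.

Lemma sum_sl x : \sum_(p <- s) j (EM (x * val p.1)) * val p.2 = x.
Proof. by have := (sP x).1; rewrite big_map. Qed.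

Lemma sum_sr x : \sum_(p <- s) val p.1 * j (EM (val p.2 * x)) = x.
Proof. by have := (sP x).2; rewrite big_map. Qed.

(** Expand c = E_M(c a_i) b_i along dual bases in A. The coefficients lie in U,
    and T_0(E_M(c a_i) u) = T_1(c a_i u) vanishes for every u in U. *)
Lemma T1_nondeg c : c \in centralizer (fun n : N => j (i n)) ->
  (forall d, d \in centralizer (fun n : N => j (i n)) -> T1 (c * d) = 0) ->
  c = 0.
Proof.
move=> cA h; rewrite -[c]sum_sl big1 // => p _.
suff -> : EM (c * val p.1) = 0 by rewrite linear0 mul0r.
have uU : EM (c * val p.1) \in centralizer i.
  by apply: E1_cent; apply: rpredM cA (valP p.1).
pose u : U F := exist _ (EM (c * val p.1)) uU.
suff /(congr1 val) : u = 0 by [].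
apply: ndU => u'; rewrite [val u]/(EM _) -T1_mulr -mulrA h //.
by apply: rpredM (valP p.1) (i1_cent (valP u')).
Qed.

(** [frobenius_symmetric] for M_1 / N, whose dual bases are the products of
    those of M_1 / M and M / N. *)
Lemma EE1_sym c x : c \in centralizer (fun n : N => j (i n)) ->
  E (EM (c * x)) = E (EM (x * c)).
Proof.
move=> cA.
pose G : {linear M1 F -> N} := E \o EM.
pose ii : {lrmorphism N -> M1 F} := j \o i.
pose d := [seq (p.1 * j q.1, j q.2 * p.2) | p <- dbas (F1 F), q <- dbas F].
have dP : dual_bases (fun n => j (i n)) (fun x => E (EM x)) d.
  move=> y; rewrite /d !big_allpairs_dep /=; split.
    rewrite -[RHS]dbas_F1l; apply: eq_bigr => p _.
    under eq_bigr do rewrite [y * _]mulrA E1_mulr mulrA -i1M.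
    by rewrite -mulr_suml -(linear_sum j) /= dbasl.
  rewrite -[RHS]dbas_F1r; apply: eq_bigr => p _.
  under eq_bigr do rewrite -[j _ * _ * _]mulrA E1_mull -mulrA -i1M.
  by rewrite -mulr_sumr -(linear_sum j) /= dbasr.
apply: (@frobenius_symmetric k N (M1 F) ii G d T _ dP).
- by move=> n y n' /=; rewrite E1_mulA cexp_bimod.
- exact: T1C.
- exact: T1_nondeg.
- exact: cA.
Qed.

End Markov.

(** * Symmetric separability elements *)

Section TensK.
Variables (k : fieldType) (X Y Z : lmodType k) (h : X -> Y -> Z).
Hypothesis h_l : forall y, linear (h^~ y).
Hypothesis h_r : forall x, linear (h x).

Lemma bilinear_balanced :
  balanced (fun x (c : k) => c *: x) (fun c y => c *: y) h.
Proof.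
have l0 y : h 0 y = 0.
  by have := h_l y (-1) 0 0; rewrite scaler0 addr0 scaleN1r addNr.
have r0 x : h x 0 = 0.
  by have := h_r x (-1) 0 0; rewrite scaler0 addr0 scaleN1r addNr.
split=> // x c y.
have := h_l y c x 0; have := h_r x c y 0.
by rewrite !addr0 l0 r0 !addr0 => -> ->.
Qed.

End TensK.

Section Separability.
Variables (k : fieldType) (R : algType k) (t : {scalar R}).
Hypothesis tr : is_trace t.
Variable f : tensk R R.
Hypothesis fP : sym_sep_element f.
Local Notation c := (\sum_(p <- repr f) t p.2 *: p.1).

Lemma sym_sep_swap (Z : lmodType k) (h : R -> R -> Z) :
  (forall y, linear (h^~ y)) -> (forall x, linear (h x)) ->
  \sum_(p <- repr f) h p.2 p.1 = \sum_(p <- repr f) h p.1 p.2.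
Proof.
move=> hl hr; have hb := bilinear_balanced hl hr.
transitivity (tlift h f); last by [].
by rewrite -[in RHS]fP.2 (tlift_sum hb).
Qed.

(** The bimodule property of a separability element, read through an arbitrary
    bilinear map. *)
Lemma sep_central (Z : lmodType k) (h : R -> R -> Z) r :
  (forall y, linear (h^~ y)) -> (forall x, linear (h x)) ->
  \sum_(p <- repr f) h (r * p.1) p.2 = \sum_(p <- repr f) h p.1 (p.2 * r).
Proof.
move=> hl hr; have hb := bilinear_balanced hl hr.
have /(congr1 (tlift h)) := fP.1.1 r.
by rewrite !(tlift_sum hb).
Qed.

Lemma sep_mul : \sum_(p <- repr f) p.1 * p.2 = 1.
Proof. exact: fP.1.2. Qed.

Lemma sep_mulC : \sum_(p <- repr f) p.2 * p.1 = 1.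
Proof.
rewrite (sym_sep_swap (h := fun x y => x * y)) ?sep_mul // => x a y z /=.
  by rewrite mulrDl scalerAl.
by rewrite mulrDr scalerAr.
Qed.

Let ht_l (y : R) : linear ((fun x y : R => t x *: y)^~ y).
Proof. by move=> a x x' /=; rewrite linearP scalerDl scalerA. Qed.
Let ht_r (x : R) : linear ((fun x y : R => t x *: y) x).
Proof. by move=> a y y' /=; rewrite scalerDr !scalerA mulrC. Qed.

Lemma sep_sliceC : c = \sum_(p <- repr f) t p.1 *: p.2.
Proof. exact: (sym_sep_swap (h := fun x y => t x *: y)). Qed.

(** With [sep_slicel] this shows that the slice of f by a trace is central. *)
Lemma sep_slicer r : \sum_(p <- repr f) t (r * p.1) *: p.2 = c * r.
Proof.
rewrite sep_sliceC mulr_suml (sep_central r ht_l ht_r).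
by apply: eq_bigr => p _; rewrite scalerAl.
Qed.

Lemma sep_slicel r : \sum_(p <- repr f) t (r * p.1) *: p.2 = r * c.
Proof.
have hl (y : R) : linear ((fun x y : R => t y *: x)^~ y).
  by move=> a x x' /=; rewrite scalerDr !scalerA mulrC.
have hr (x : R) : linear ((fun x y : R => t y *: x) x).
  by move=> a y y' /=; rewrite linearP scalerDl scalerA.
have := sep_central r hl hr.
under eq_bigr do rewrite scalerAr.
rewrite -mulr_sumr => ->.
under [RHS]eq_bigr do rewrite tr.
have kl (y : R) : linear ((fun x y : R => t (r * x) *: y)^~ y).
  by move=> a x x' /=; rewrite mulrDr -scalerAr linearP scalerDl scalerA.
have kr (x : R) : linear ((fun x y : R => t (r * x) *: y) x).
  by move=> a y y' /=; rewrite scalerDr !scalerA mulrC.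
exact: esym (sym_sep_swap kl kr).
Qed.

Variable w : R.
Hypothesis wl : w * c = 1.
Hypothesis wr : c * w = 1.

(** Correcting f by the inverse of its slice turns it into dual bases of the
    trace t. *)
Lemma sep_dualr r : r = \sum_(p <- repr f) t (r * p.1) *: (p.2 * w).
Proof.
under eq_bigr do rewrite scalerAl.
by rewrite -mulr_suml sep_slicel -mulrA wr mulr1.
Qed.

Lemma sep_duall r : r = \sum_(p <- repr f) t (r * p.1) *: (w * p.2).
Proof.
under eq_bigr do rewrite scalerAr.
by rewrite -mulr_sumr sep_slicer mulrA wl mul1r.
Qed.
End Separability.

(** * The anti-isomorphism of V with U *)

Section Chi.
Variables (k : fieldType) (F : ssext k) (T : {scalar base F}).
Hypothesis hMarkov : symmetric_markov T.
Hypothesis hprod :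
  symmetric_product F \/ forall u : U F, T0 T (val u) = T1 T (phi u).
Local Notation N := (base F).
Local Notation M := (top F).
Local Notation i := (@incl k F).
Local Notation E := (@cexp k F).
Local Notation j := (i1 F).
Local Notation EM := (E1 F).
Local Notation e := (e1 F).
Local Notation lam := (lam F).
Local Notation T0 := (T0 T).
Local Notation T1 := (T1 T).

(** The inverse of phi, which exists on all of V: v e = chi(v) e with chi(v) in
    M. *)
Definition chi (v : V F) : M := lam^-1 *: EM (val v * e).

Lemma chi_linear : linear chi.
Proof.
move=> a v v'; rewrite /chi linearP mulrDl -scalerAl linearP scalerDr.
by rewrite !scalerA mulrC.
Qed.
HB.instance Definition _ := GRing.isLinear.Build k (V F) M *:%R chi chi_linear.

Lemma chiZ a v : chi (a *: v) = a *: chi v.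
Proof. exact: linearZZ. Qed.

Lemma chi_sum I (r : seq I) (h : I -> V F) :
  chi (\sum_(p <- r) h p) = \sum_(p <- r) chi (h p).
Proof. exact: raddf_sum. Qed.

Lemma chi_e1 v : val v * e = j (chi v) * e.
Proof. by rewrite push_e1 /chi i1Z scalerAl. Qed.

Lemma chi_cent v : chi v \in centralizer i.
Proof.
by apply: rpredZ; apply: E1_cent; apply: rpredM (V_cent v) (e1_cent F).
Qed.

Lemma chiM v v' : chi (v * v') = chi v' * chi v.
Proof.
apply: e1_inj; rewrite -chi_e1 rmorphM -mulrA chi_e1 mulrA -valV_comm.
by rewrite -mulrA chi_e1 mulrA -i1M.
Qed.

Lemma chi1 : chi 1 = 1.
Proof. by apply: e1_inj; rewrite -chi_e1 !rmorph1. Qed.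

Lemma phi_chi v : val v = \sum_(p <- dbas F) j (p.1 * chi v) * e * j p.2.
Proof.
rewrite -[val v]mulr1 -(sum_e1 F) mulr_sumr; apply: eq_bigr => p _.
by rewrite i1M -[j p.1 * _ * e]mulrA -chi_e1 !mulrA valV_comm.
Qed.

(** On the left of e, v is also replaced by chi(v). This is where the symmetry
    E(u x) = E(x u) for u in U enters. *)
Lemma e1_chi v : e * val v = e * j (chi v).
Proof.
rewrite phi_chi mulr_sumr.
have cu := (centralizerP _ _ (chi_cent v)).
have Esym x : E (chi v * x) = E (x * chi v).
  by case: hMarkov => _ _ _ /(_ (exist _ (chi v) (chi_cent v) : U F) x).
under eq_bigr do rewrite !mulrA e1_midr -Esym -mulrA -i1M.
by rewrite -mulr_sumr -(raddf_sum j) dbasl.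
Qed.

(** Each form of the hypothesis on y_i x_i gives this compatibility of traces.
    *)
Lemma T0_phi (u : U F) : T0 (val u) = T1 (phi u).
Proof.
case: hprod => [h|]; last exact.
rewrite /phi T1_sum.
under eq_bigr do rewrite T1_pure (T0C hMarkov) mulrA.
rewrite -mulr_sumr -T0_sum -mulr_suml h -scalerAl mul1r T0Z.
by rewrite mulrA divff ?lam_neq0 ?mul1r.
Qed.

Lemma T0_chi v : T0 (chi v) = T1 (val v).
Proof. by rewrite phi_chi; exact: (T0_phi (exist _ (chi v) (chi_cent v))). Qed.

Lemma phi_cent (u : U F) : phi u \in centralizer j.
Proof.
apply/centralizerP => m; rewrite /phi.
under eq_bigr do rewrite i1M -[_ * _ * e]mulrA.
by apply: dbas_central => n; rewrite mulrA -i1M valU_comm i1M -!mulrA e1_base.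
Qed.

Lemma chi_surj (u : M) : u \in centralizer i -> exists v : V F, chi v = u.
Proof.
move=> uU; pose u' : U F := exist _ u uU.
exists (exist _ (phi u') (phi_cent u')).
apply: e1_inj; rewrite -chi_e1 [val _]/(phi u') /phi mulr_suml.
under eq_bigr do rewrite -!mulrA [e * _]mulrA e1_mid mulrA -i1M -mulrA
  -(centralizerP _ _ uU) mulrA.
by rewrite -mulr_suml -(raddf_sum j) -mulr_suml dbas1r mul1r.
Qed.

End Chi.

(** * Trace forms on A: transposition and dual bases *)

Section DualBasesA.
Variables (k : fieldType) (F : ssext k) (T : {scalar base F}).
Hypothesis hMarkov : symmetric_markov T.
Hypothesis hprod :
  symmetric_product F \/ forall u : U F, T0 T (val u) = T1 T (phi u).
Local Notation N := (base F).
Local Notation M := (top F).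
Local Notation i := (@incl k F).
Local Notation E := (@cexp k F).
Local Notation j := (i1 F).
Local Notation EM := (E1 F).
Local Notation e := (e1 F).
Local Notation lam := (lam F).
Local Notation cA := (centralizer (fun n : N => j (i n))).
Local Notation T0 := (T0 T).
Local Notation T1 := (T1 T).

(** The anti-automorphism of A exchanging the two actions of A on M, given by m
    |-> lam^-1 E_M(a m e) and m |-> lam^-1 E_M(e m a); see [E1_tau]. *)
Definition tau (a : M1 F) : M1 F :=
  lam^-1 *: \sum_(p <- dbas F) j p.1 * e * j (EM (a * j p.2 * e)).

Lemma e1_tau a m : a \in cA ->
  e * j m * tau a = lam^-1 *: (e * j (EM (a * j m * e))).
Proof.
move=> /centralizerP aA; rewrite /tau -scalerAr mulr_sumr; congr (_ *: _).
under eq_bigr do rewrite !mulrA -[e * _ * j _]mulrA -i1M e1_midr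
  -[e * j (i _) * _]mulrA -i1M -E1_mull !mulrA aA -[a * _ * j _]mulrA -i1M.
by rewrite -mulr_sumr -!raddf_sum -mulr_suml -mulr_sumr -raddf_sum dbasl.
Qed.

Lemma E1_tau a m : a \in cA -> EM (e * j m * tau a) = EM (a * j m * e).
Proof.
by move=> aA; rewrite e1_tau // E1Z E1_mulr E1_e1 -scalerAl mul1r lamK.
Qed.

(** The right action of M_1 on M is faithful, since x_i e y_i = 1. *)
Lemma e1_faithful x y :
  (forall m, EM (e * j m * x) = EM (e * j m * y)) -> x = y.
Proof.
suff h z : z =
    \sum_(p <- dbas F) j p.1 * (lam^-1 *: (e * j (EM (e * j p.2 * z)))).
  by move=> hxy; rewrite [x]h [y]h; apply: eq_bigr => p _; rewrite hxy.
rewrite -[z in LHS]mul1r -(sum_e1 F) mulr_suml.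
by apply: eq_bigr => p _; rewrite -!mulrA {1}e1_push.
Qed.

Lemma tau_cent a : a \in cA -> tau a \in cA.
Proof.
move=> aA; apply/centralizerP => n; apply: e1_faithful => m.
rewrite !mulrA -[e * _ * j _]mulrA -i1M E1_mulr !E1_tau // i1M.
by rewrite -!mulrA e1_base !mulrA E1_mulr.
Qed.

(** The adjoint of [tau] for the form T_1(a c) on A, by [T1_tau_adj]. *)
Definition tau_adj (c : M1 F) : M1 F :=
  lam^-1 *: \sum_(p <- dbas F) j (EM (e * j p.1 * c)) * e * j p.2.

(** The sum of the x_i d y_i is an element v of V, on which multiplication by e
    scales T_1 by lam; the compatibility [T0_phi] converts the result to T_1(d).
    *)
Lemma T1_e1_sum d : d \in cA ->
  \sum_(p <- dbas F) T1 (e * j p.1 * d * j p.2) = T1 d.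
Proof.
move=> dA; pose v := \sum_(p <- dbas F) j p.1 * d * j p.2.
have vV : v \in centralizer j.
  by apply/centralizerP => m; apply: dbas_central; apply/centralizerP.
pose v' : V F := exist _ v vV.
transitivity (T1 (e * v)).
  by rewrite mulr_sumr T1_sum; apply: eq_bigr => p _; rewrite !mulrA.
have -> : e * v = e * j (chi v') := e1_chi hMarkov v'.
rewrite T1_mulr E1_e1 -scalerAl mul1r T0Z (T0_chi hMarkov hprod).
have -> : val v' = v by [].
rewrite /v T1_sum.
transitivity (lam * \sum_(p <- dbas F) T0 (p.1 * EM d * p.2)).
  by congr (_ * _); apply: eq_bigr => p _; rewrite T1E E1_mulA.
pose u : U F := exist _ (EM d) (E1_cent dA).
have -> : T1 d = T1 (phi u) by rewrite -(T0_phi hMarkov hprod).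
rewrite /phi T1_sum mulr_sumr; apply: eq_bigr => p _.
by rewrite T1_pure.
Qed.

(** Replacing the action of a on E_M(e x_i c) by the right action of tau(a)
    turns the left side into the sum of the T_1(e x_i c tau(a) y_i), which
    [T1_e1_sum] evaluates. *)
Lemma T1_tau_adj a c :
  a \in cA -> c \in cA -> T1 (a * tau_adj c) = T1 (c * tau a).
Proof.
move=> aA cA; rewrite /tau_adj -scalerAr T1Z mulr_sumr T1_sum mulr_sumr.
rewrite -[RHS]T1_e1_sum; last exact: rpredM (tau_cent aA).
apply: eq_bigr => p _; rewrite !mulrA.
rewrite [a * _ * e]push_e1 -scalerAl T1Z T1_pure [_^-1 * (lam * _)]mulrA.
rewrite mulVf ?lam_neq0 // mul1r -E1_tau //.
rewrite -T1_mulr -T1Z -[e * j p.1 * c]mulrA.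
by rewrite [in RHS]e1_push -!scalerAl.
Qed.

Variable s : seq (A F * A F).
Hypothesis sP : dual_bases j EM [seq (val p.1, val p.2) | p <- s].
Variable f : tensk (V F) (V F).
Hypothesis fP : sym_sep_element f.
Variable w : V F.
Hypothesis wl : w * slice_T T f = 1.
Hypothesis wr : slice_T T f * w = 1.

Let tV : {scalar V F} := T1 \o val.

Lemma slice_TE : slice_T T f = \sum_(p <- repr f) T1 (val p.2) *: p.1.
Proof. by apply: eq_bigr => p _; rewrite [Defs.T2 _ _]/(T1 (E2 F _)) E2_id. Qed.

Lemma tV_trace : is_trace tV.
Proof.
have tVE x : tV x = T1 (val x) by [].
by move=> x y; rewrite !tVE !valVM (T1C hMarkov).
Qed.

(** Dual bases of T_1 on V are carried by chi to dual bases of T_0 on U. *)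
Lemma chi_dual (v : V F) (h : V F -> V F) :
  v = \sum_(p <- repr f) tV (v * p.1) *: h p.2 ->
  chi v = \sum_(p <- repr f) T0 (chi v * chi p.1) *: chi (h p.2).
Proof.
move=> {1}->; rewrite chi_sum; apply: eq_bigr => p _.
by rewrite chiZ -[tV _](T0_chi hMarkov hprod) chiM (T0C hMarkov).
Qed.

(** The factor chi(w) may stand on either side of the second leg, w being
    central. *)
Lemma U_duall u : u \in centralizer i ->
  u = \sum_(p <- repr f) T0 (u * chi p.1) *: (chi w * chi p.2).
Proof.
move=> /chi_surj [v <-]; under eq_bigr do rewrite -[chi w * _]chiM.
apply: (@chi_dual v (fun x => x * w)).
by apply: (sep_dualr tV_trace fP); rewrite -wr slice_TE.
Qed.

Lemma U_dualr u : u \in centralizer i ->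
  u = \sum_(p <- repr f) T0 (u * chi p.1) *: (chi p.2 * chi w).
Proof.
move=> /chi_surj [v <-]; under eq_bigr do rewrite -[_ * chi w]chiM.
apply: (@chi_dual v (fun x => w * x)).
by apply: (sep_duall fP); rewrite -wl slice_TE.
Qed.

Lemma chi_mul : \sum_(p <- repr f) chi p.1 * chi p.2 = 1.
Proof.
under eq_bigr do rewrite -chiM.
by rewrite -chi_sum (sep_mulC fP) chi1.
Qed.

Lemma chi_mulC : \sum_(p <- repr f) chi p.2 * chi p.1 = 1.
Proof.
under eq_bigr do rewrite -chiM.
by rewrite -chi_sum (sep_mul fP) chi1.
Qed.

Lemma chi_invl : chi w * chi (slice_T T f) = 1.
Proof. by rewrite -chiM wr chi1. Qed.

Lemma chi_invr : chi (slice_T T f) * chi w = 1.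
Proof. by rewrite -chiM wl chi1. Qed.

Lemma chiA_subproof v : j (chi v) \in cA.
Proof. exact: i1_cent (chi_cent v). Qed.
Definition chiA v : A F := exist _ (j (chi v)) (chiA_subproof v).

(** Two dual bases of T_1 on A, each obtained from dual bases of E_M over M and
    of T_0 over U. They differ in the side on which the U-part is multiplied:
    contracting an expression with them cancels the U-part when it stands
    between the A-parts as in [dual1_contract] and [dual2_contract]. *)
Definition dual1 : seq (A F * A F) :=
  [seq (chiA p.1 * q.2, q.1 * (chiA p.2 * chiA w)) | q <- s, p <- repr f].
Definition dual2 : seq (A F * A F) :=
  [seq (q.1 * chiA p.1, (chiA w * chiA p.2) * q.2) | q <- s, p <- repr f].

Lemma big_dual1 (Z : nmodType) (G : A F -> A F -> Z) :
  \sum_(d <- dual1) G d.1 d.2 =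
  \sum_(q <- s) \sum_(p <- repr f)
    G (chiA p.1 * q.2) (q.1 * (chiA p.2 * chiA w)).
Proof. exact: big_allpairs_dep. Qed.

Lemma big_dual2 (Z : nmodType) (G : A F -> A F -> Z) :
  \sum_(d <- dual2) G d.1 d.2 =
  \sum_(q <- s) \sum_(p <- repr f)
    G (q.1 * chiA p.1) ((chiA w * chiA p.2) * q.2).
Proof. exact: big_allpairs_dep. Qed.

Lemma val_chiA v : val (chiA v) = j (chi v). Proof. by []. Qed.

Lemma dual1P a : a = \sum_(d <- dual1) T1 (val a * val d.1) *: d.2.
Proof.
apply: val_inj.
rewrite valA_sum (big_dual1 (fun x y => val (T1 (val a * val x) *: y))).
rewrite -[val a in LHS](sum_sr sP); apply: eq_bigr => q _.
rewrite [EM (val q.2 * val a) in LHS]U_dualr; last first.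
  by apply: E1_cent; apply: rpredM (valP _) (valP _).
rewrite i1_sum mulr_sumr; apply: eq_bigr => p _.
rewrite [RHS]valAZ !valAM !val_chiA i1Z i1M -scalerAr; congr (_ *: _).
by rewrite -T1_mulr -mulrA (T1C hMarkov) -mulrA.
Qed.

Lemma dual2P a : a = \sum_(d <- dual2) T1 (val a * val d.1) *: d.2.
Proof.
apply: val_inj.
rewrite valA_sum (big_dual2 (fun x y => val (T1 (val a * val x) *: y))).
rewrite -[val a in LHS](sum_sl sP); apply: eq_bigr => q _.
rewrite [EM (val a * val q.1) in LHS]U_duall; last first.
  by apply: E1_cent; apply: rpredM (valP _) (valP _).
rewrite i1_sum mulr_suml; apply: eq_bigr => p _.
rewrite [RHS]valAZ !valAM !val_chiA i1Z i1M -scalerAl; congr (_ *: _).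
by rewrite -T1_mulr mulrA.
Qed.

(** In the middle stand chi(f_2) chi(w) chi(w)^-1 chi(f_1), whose sum is 1. *)
Lemma dual1_contract z :
  \sum_(d <- dual1) val d.2 * j (chi (slice_T T f)) * j (EM (val d.1 * z)) = z.
Proof.
rewrite (big_dual1
  (fun x y => val y * j (chi (slice_T T f)) * j (EM (val x * z)))).
rewrite -[RHS](sum_sr sP); apply: eq_bigr => q _.
under eq_bigr do rewrite !valAM !val_chiA -mulrA -i1M -!mulrA E1_mull -!i1M
  -!mulrA
  [chi w * (_ * _)]mulrA chi_invl mul1r mulrA i1M.
by rewrite -mulr_sumr -mulr_suml -i1_sum chi_mulC rmorph1 mul1r.
Qed.

Lemma dual2_contract z :
  \sum_(d <- dual2) j (EM (z * val d.1)) * j (chi (slice_T T f)) * val d.2 = z.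
Proof.
rewrite (big_dual2
  (fun x y => j (EM (z * val x)) * j (chi (slice_T T f)) * val y)).
rewrite -[RHS](sum_sl sP); apply: eq_bigr => q _.
under eq_bigr do rewrite !valAM !val_chiA [z * _]mulrA E1_mulr !mulrA -!i1M
   -[_ * chi (slice_T T f) * _]mulrA chi_invr mulr1 -[_ * chi _ * chi _]mulrA
     i1M.
by rewrite -mulr_suml -mulr_sumr -i1_sum chi_mul rmorph1 mulr1.
Qed.

End DualBasesA.

(** * Comultiplication, counit and antipode as formulas in the first step *)

Section Pairing.
Variables (k : fieldType) (F : ssext k) (T : {scalar base F}).
Hypothesis hMarkov : symmetric_markov T.
Hypothesis hprod :
  symmetric_product F \/ forall u : U F, T0 T (val u) = T1 T (phi u).
Local Notation N := (base F).
Local Notation M := (top F).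
Local Notation i := (@incl k F).
Local Notation E := (@cexp k F).
Local Notation j := (i1 F).
Local Notation jj := (i2 F).
Local Notation EM := (E1 F).
Local Notation e := (e1 F).
Local Notation ee := (e2 F).
Local Notation lam := (lam F).
Local Notation cA := (centralizer (fun n : N => j (i n))).
Local Notation T0 := (T0 T).
Local Notation T1 := (T1 T).
Local Notation T2 := (T2 T).
Hypothesis T1_nd : forall c, c \in cA ->
  (forall d, d \in cA -> T1 (c * d) = 0) -> c = 0.
Variables w w' : V F.
Hypothesis wl : w * w' = 1.

Lemma T2E x : T2 x = T1 (E2 F x). Proof. by []. Qed.

Lemma val_wK : val w * val w' = 1. Proof. by rewrite -valVM wl. Qed.

Lemma T1_inj x y : x \in cA -> y \in cA ->
  (forall d, d \in cA -> T1 (x * d) = T1 (y * d)) -> x = y.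
Proof.
move=> xA yA h; apply/subr0_eq/T1_nd => [|d dA]; first exact: rpredB.
by rewrite mulrBl T1B h // subrr.
Qed.

Lemma E2_cent y :
  (forall n, jj (j (i n)) * y = y * jj (j (i n))) -> E2 F y \in cA.
Proof. by move=> h; apply/centralizerP => n; rewrite -E2_mull h E2_mulr. Qed.

(** The element of B whose pairing with a is T_1(a c); see [pairing_Brep]. The
    outer sum puts e_1 e_2 c, which commutes with N, into the centralizer of M.
    *)
Definition Brep_elt (c : M1 F) : M2 F :=
  \sum_(p <- dbas F) jj (val w' * j p.1 * e) * ee * jj (c * j p.2).

Lemma Brep_cent c :
  c \in cA -> Brep_elt c \in centralizer (fun m : M => jj (j m)).
Proof.
move=> /centralizerP hc; apply/centralizerP => m.
have -> : Brep_elt c = jj (val w') *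
    \sum_(p <- dbas F) jj (j p.1) * (jj e * ee * jj c) * jj (j p.2).
  by rewrite mulr_sumr; apply: eq_bigr => p _; rewrite !i2M !mulrA.
rewrite mulrA -i2M valV_comm i2M -!mulrA; congr (_ * _).
apply: (@dbas_central k F (M2 F) (jj \o j)) => n /=.
rewrite !mulrA -i2M e1_base i2M -[jj e * _ * ee]mulrA -e2_M.
by rewrite -!mulrA -!i2M hc.
Qed.

Definition Brep (a : A F) : B F :=
  exist _ (Brep_elt (val a)) (Brep_cent (valP a)).

(** The element of M_1 that represents pairing with y through the form T_1; see
    [pairingE]. *)
Definition mate (y : M2 F) : M1 F := E2 F (ee * jj e * jj (val w) * y).

Lemma pairingE a (b : B F) :
  pairing T w a b = lam ^- 2 * T1 (val a * mate (val b)).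
Proof. by rewrite /pairing T2E /mate -!mulrA E2_mull. Qed.

Lemma mate_Brep c : mate (val (Brep c)) = lam ^+ 2 *: val c.
Proof.
rewrite /mate [val (Brep c)]/(Brep_elt (val c)) /Brep_elt mulr_sumr E2_sum.
transitivity (\sum_(p <- dbas F) lam ^+ 2 *: (val c * j (i (E p.1) * p.2))).
  apply: eq_bigr => p _.
  rewrite -!mulrA [jj (val w) * _]mulrA -i2M !mulrA val_wK mul1r.
  rewrite -[ee * _ * _]mulrA -i2M !mulrA e2_mid e1_mid E1_mull E1_e1.
  rewrite E2_mulA E2_e2 -scalerAr mulr1 -scalerAr mulr1 i1Z -!scalerAl scalerA.
  by rewrite i1M !mulrA valA_comm.
rewrite -scaler_sumr -mulr_sumr -i1_sum dbas1l rmorph1.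
by rewrite mulr1.
Qed.

Lemma pairing_Brep a c : pairing T w a (Brep c) = T1 (val a * val c).
Proof.
rewrite pairingE mate_Brep -scalerAr T1Z mulrA mulVf ?mul1r //.
by rewrite expf_neq0 ?lam_neq0.
Qed.

Lemma pairing_inj (a a' : A F) :
  (forall b, pairing T w a b = pairing T w a' b) -> a = a'.
Proof.
move=> h; apply/val_inj/T1_inj; try exact: valP.
move=> d dA; pose d' : A F := exist _ d dA.
by have := h (Brep d'); rewrite !pairing_Brep.
Qed.

Lemma pairingZl c a b : pairing T w (c *: a) b = c * pairing T w a b.
Proof. by rewrite !pairingE valAZ -scalerAl T1Z mulrCA. Qed.

Lemma pairing_suml I (r : seq I) (h : I -> A F) b :
  pairing T w (\sum_(p <- r) h p) b = \sum_(p <- r) pairing T w (h p) b.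
Proof.
rewrite pairingE valA_sum mulr_suml T1_sum mulr_sumr.
by apply: eq_bigr => p _; rewrite pairingE.
Qed.

Variable Delta : {linear A F -> tensk (A F) (A F)}.
Hypothesis hDelta : is_comult T w Delta.

Lemma E2_bae_cent (a : A F) (b : B F) :
  lam^-1 *: E2 F (val b * jj (val a) * ee) \in cA.
Proof.
apply: rpredZ; apply: E2_cent => n.
rewrite !mulrA valB_comm -!mulrA e2_M; congr (_ * _).
by rewrite !mulrA -!i2M valA_comm.
Qed.

(** Pairing both sides with b' gives <a, b' b>. For the right side, the trace
    moves b in front of a e_2, and b a e_2 = lam^-1 E_{M_1}(b a e_2) e_2. *)
Lemma comult_slice (a : A F) (b : B F) :
  \sum_(p <- repr (Delta a)) pairing T w p.2 b *: (val p.1 : M1 F) =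
  lam^-1 *: E2 F (val b * jj (val a) * ee).
Proof.
pose x : A F := \sum_(p <- repr (Delta a)) pairing T w p.2 b *: p.1.
pose y : A F :=
  exist _ (lam^-1 *: E2 F (val b * jj (val a) * ee)) (E2_bae_cent a b).
suff xy : x = y.
  transitivity (val x); last by rewrite xy.
  by rewrite valA_sum; apply: eq_bigr => p _; rewrite valAZ.
apply: pairing_inj => b'.
transitivity (pairing T w a (b' * b)).
  rewrite -hDelta pairing_suml; apply: eq_bigr => p _.
  by rewrite pairingZl mulrC.
rewrite /pairing; congr (_ * _).
have -> : val (b' * b) = val b' * val b by [].
have -> : val y = lam^-1 *: E2 F (val b * jj (val a) * ee) by [].
by rewrite mulrA (T2C hMarkov) !mulrA [in LHS]e2_push i2Z -!scalerAl.
Qed.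

(** [comult_slice] for the element of B that represents T_1(- c). *)
Lemma comult_T1 (a c : A F) :
  \sum_(p <- repr (Delta a)) T1 (val p.2 * val c) *: (val p.1 : M1 F) =
  val w' * \sum_(p <- dbas F) j p.1 * e * j (EM (val c * j p.2 * val a)).
Proof.
under eq_bigr do rewrite -pairing_Brep.
rewrite comult_slice [val (Brep c)]/(Brep_elt (val c)) /Brep_elt.
rewrite -mulrA mulr_suml E2_sum scaler_sumr mulr_sumr; apply: eq_bigr => p _.
rewrite -!mulrA [jj (val c * _) * _]mulrA -i2M [ee * _]mulrA e2_mid.
rewrite [jj _ * (_ * ee)]mulrA -i2M E2_mull E2_e2 -scalerAr mulr1 lamK.
by rewrite -!mulrA.
Qed.

Lemma counitE (a : A F) : counit T w a = lam^-1 * T1 (val a * e * val w).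
Proof.
rewrite /counit /pairing T2E; have -> : val (1 : B F) = 1 by [].
rewrite mulr1 -!mulrA -i2M E2_mull E2_mulr E2_e2 -scalerAl mul1r -scalerAr T1Z.
rewrite [LHS]mulrA expr2 invfM -[_ * lam]mulrA mulVf ?lam_neq0 //.
by rewrite mulr1 !mulrA.
Qed.

Variables (SB : {linear B F -> B F}) (S : {linear A F -> A F}).
Hypothesis hSB :
  forall (a : A F) (b : B F), pairing T w a b = pairing' T w a (SB b).
Hypothesis hS :
  forall (a : A F) (b : B F), pairing T w (S a) b = pairing T w a (SB b).

(** The defining relation of S_B says that E_{M_1}(S_B(b) e_1 e_2) w is lam^2 c,
    because both have the same scalar products with A. By the Temperley-Lieb
    relation this determines S_B(b) e_1, hence S_B(b) = x_i S_B(b) e_1 y_i. *)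
Lemma mate_SB (c : A F) :
  mate (val (SB (Brep c))) = lam ^+ 2 *: tau_adj (val w * val c * val w').
Proof.
set b := SB (Brep c).
have lam2 : lam ^+ 2 != 0 by rewrite expf_neq0 ?lam_neq0.
have bA : E2 F (val b * jj e * ee) \in cA.
  apply: E2_cent => n; rewrite !mulrA valB_comm -!mulrA e2_M.
  by rewrite [jj (j _) * (_ * _)]mulrA -i2M e1_base i2M !mulrA.
have hE : E2 F (val b * jj e * ee) = lam ^+ 2 *: (val c * val w').
  have h : E2 F (val b * jj e * ee) * val w = lam ^+ 2 *: val c.
    apply: T1_inj.
    - exact: rpredM bA (V_cent w).
    - by apply: rpredZ; exact: valP.
    - move=> d dA; pose d' : A F := exist _ d dA.
      have := hSB d' (Brep c); rewrite pairing_Brep /pairing' -/b T2E.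
      have -> : val d' = d by [].
      rewrite !E2_mulr => h.
      by rewrite -scalerAl T1Z (T1C hMarkov (val c)) h mulrA divff ?mul1r.
  by rewrite scalerAl -h -[_ * val w * _]mulrA val_wK mulr1.
have be : val b * jj e = jj (val c * val w') * ee * jj e.
  apply: (can_inj (@lamK _ F (M2 F))).
  rewrite scalerAr -e1e2e1 !mulrA [val b * jj e * ee]e2_push hE i2Z -!scalerAl.
  by rewrite scalerA expr2 mulrA mulVf ?lam_neq0 // mul1r.
have -> : val b = \sum_(p <- dbas F) jj (j p.1) * (val b * jj e) * jj (j p.2).
  have h1 : \sum_(p <- dbas F) jj (j p.1 * e * j p.2) = 1.
    by rewrite -i2_sum sum_e1 rmorph1.
  rewrite -[val b in LHS]mulr1 -h1 mulr_sumr.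
  by apply: eq_bigr => p _; rewrite !i2M !mulrA valB_comm.
rewrite be /mate mulr_sumr E2_sum /tau_adj scalerA expr2 mulfK ?lam_neq0 //.
rewrite scaler_sumr; apply: eq_bigr => p _.
transitivity (E2 F (ee * jj (e * j p.1 * (val w * val c * val w')) * ee
    * jj (e * j p.2))).
  congr (E2 F _); rewrite !mulrA !i2M !mulrA.
  rewrite -[_ * jj (val w) * jj (j p.1)]mulrA.
  by rewrite -i2M -valV_comm i2M !mulrA.
by rewrite e2_mid E2_mulA E2_e2 -scalerAr mulr1 -scalerAl -!mulrA.
Qed.

(** S is the T_1-transpose of the map computed in [mate_SB]. *)
Lemma antipodeE a : val (S a) = val w' * tau (val a) * val w.
Proof.
have aA := valP a; have wA := V_cent w; have wA' := V_cent w'.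
apply: T1_inj; first exact: valP.
  by apply: rpredM wA; apply: rpredM wA' (tau_cent aA).
move=> d dA; pose d' : A F := exist _ d dA.
have := hS a (Brep d'); rewrite pairing_Brep pairingE mate_SB.
rewrite -scalerAr T1Z mulrA mulVf ?expf_neq0 ?lam_neq0 // mul1r.
have -> : val d' = d by [].
move=> ->; rewrite (T1_tau_adj hMarkov hprod aA); last first.
  by apply: rpredM wA'; apply: rpredM wA dA.
by rewrite -!mulrA (T1C hMarkov) -!mulrA (T1C hMarkov) -!mulrA.
Qed.

End Pairing.

(** * The action, the target subalgebra and the commutation rule *)

Section Action.
Variables (k : fieldType) (F : ssext k) (T : {scalar base F}).
Hypothesis hMarkov : symmetric_markov T.
Hypothesis hprod :
  symmetric_product F \/ forall u : U F, T0 T (val u) = T1 T (phi u).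
Hypothesis ndU :
  forall u : U F, (forall u' : U F, T0 T (val u * val u') = 0) -> u = 0.
Variable s : seq (A F * A F).
Hypothesis sP : dual_bases (i1 F) (E1 F) [seq (val p.1, val p.2) | p <- s].
Variable f : tensk (V F) (V F).
Hypothesis fP : sym_sep_element f.
Variable w : V F.
Local Notation w' := (slice_T T f).
Hypothesis wl : w * w' = 1.
Hypothesis wr : w' * w = 1.
Variable Delta : {linear A F -> tensk (A F) (A F)}.
Hypothesis hDelta : is_comult T w Delta.
Variables (SB : {linear B F -> B F}) (S : {linear A F -> A F}).
Hypothesis hSB :
  forall (a : A F) (b : B F), pairing T w a b = pairing' T w a (SB b).
Hypothesis hS :
  forall (a : A F) (b : B F), pairing T w (S a) b = pairing T w a (SB b).
Variable act : A F -> M0 F -> M0 F.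
Hypothesis hact : is_adj_action Delta S act.

Local Notation N := (base F).
Local Notation M := (top F).
Local Notation i := (@incl k F).
Local Notation E := (@cexp k F).
Local Notation j := (i1 F).
Local Notation EM := (E1 F).
Local Notation e := (e1 F).
Local Notation lam := (lam F).
Local Notation cA := (centralizer (fun n : N => j (i n))).
Local Notation T0 := (T0 T).
Local Notation T1 := (T1 T).
Local Notation D1 := (dual1 s f w).
Local Notation D2 := (dual2 s f w).

Let T1_nd := T1_nondeg sP ndU.

(** Expanding a_(2) along dual bases of T_1 replaces it by scalars T_1(a_(2) c),
    which [comult_T1] absorbs into a_(1). *)
Lemma comult_expand (D : seq (A F * A F)) (H : M1 F -> M1 F) (G : A F -> M1 F)
    (a : A F) :
  (forall a : A F, a = \sum_(d <- D) T1 (val a * val d.1) *: d.2) ->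
  linear H -> linear G ->
  \sum_(p <- repr (Delta a)) H (val p.1) * G p.2 =
  \sum_(d <- D) H (val w' *
     \sum_(p <- dbas F) j p.1 * e * j (EM (val d.1 * j p.2 * val a))) * G d.2.
Proof.
move=> DP lH lG.
pose Hl : {linear M1 F -> M1 F} :=
  HB.pack H (GRing.isLinear.Build _ _ _ _ H lH).
pose Gl : {linear A F -> M1 F} :=
  HB.pack G (GRing.isLinear.Build _ _ _ _ G lG).
have HD (c : A F) :
    H (val w' *
       \sum_(p <- dbas F) j p.1 * e * j (EM (val c * j p.2 * val a))) =
    \sum_(p <- repr (Delta a)) T1 (val p.2 * val c) *: H (val p.1).
  rewrite -(comult_T1 hMarkov T1_nd wl hDelta) -[H]/(Hl : _ -> _) linear_sum.
  by apply: eq_bigr => p _; rewrite linearZ.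
under [RHS]eq_bigr do rewrite HD mulr_suml.
rewrite exchange_big; apply: eq_bigr => p _ /=.
rewrite {1}[p.2]DP -[G]/(Gl : _ -> _) linear_sum mulr_sumr.
by apply: eq_bigr => d _; rewrite linearZ -scalerAl scalerAr.
Qed.

(** Next to e, the factor w^-1 becomes chi(w)^-1. By [e1_tau] what remains
    inside E_M is the contraction of [dual1_contract]. *)
Lemma antipode_contract z :
  \sum_(d <- D1) e * j (EM (val d.1 * z)) * val w' * tau (val d.2) =
  lam^-1 *: (e * j (EM (z * e))).
Proof.
rewrite -[in RHS](dual1_contract sP fP wr z) mulr_suml E1_sum i1_sum mulr_sumr.
rewrite scaler_sumr; apply: eq_bigr => d _.
set n := EM (val d.1 * z).
rewrite -[e * j n * _]mulrA valV_comm mulrA (e1_chi hMarkov).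
rewrite -[e * _ * j n]mulrA -[val d.2 * _ * j n]mulrA -i1M.
by rewrite e1_tau ?(valP d.2).
Qed.

(** Inserting the formulas for a_(1) and S(a_(2)), the sum over the dual bases
    collapses by [antipode_contract]. What is left is lam^-1 w^-1 x_i e y_i
    E_M(a m e) w, where x_i e y_i = 1. *)
Lemma actE a m : act a m = lam^-1 *: EM (val a * j m * e).
Proof.
rewrite -[LHS]E1_id hact.
transitivity (EM (\sum_(p <- repr (Delta a)) idfun (val p.1) *
    (j m * val (S p.2)))).
  by congr (EM _); apply: eq_bigr => p _; rewrite /= mulrA.
have lG : linear (fun q => j m * val (S q)).
  by move=> c x y; rewrite linearP valAD valAZ mulrDr scalerAr.
rewrite (@comult_expand D1 idfun (fun q => j m * val (S q)) a
  (dual1P hMarkov hprod sP fP wl)) // -[RHS]E1_id; congr (EM _).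
transitivity (\sum_(d <- D1) \sum_(p <- dbas F) val w' * (j p.1 *
  (e * j (EM (val d.1 * (j p.2 * val a * j m))) * val w' * tau (val d.2))) *
  val w).
  apply: eq_bigr => d _.
  rewrite (antipodeE hMarkov hprod T1_nd wl hSB hS) /idfun.
  rewrite -mulr_suml -mulr_sumr -!mulrA; congr (_ * _); rewrite !mulrA.
  congr (_ * _); rewrite -!mulrA mulr_suml; apply: eq_bigr => p _.
  by rewrite !mulrA E1_mulr i1M !mulrA.
rewrite exchange_big.
under eq_bigr do rewrite -mulr_suml -!mulr_sumr antipode_contract -!mulrA
  E1_mull i1M -scalerAl -!scalerAr.
transitivity (lam^-1 *: (val w' * (\sum_(p <- dbas F) j p.1 * e * j p.2)
   * j (EM (val a * (j m * e))) * val w)).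
  rewrite -scaler_sumr; congr (_ *: _); rewrite -!mulrA -mulr_sumr.
  congr (_ * _); rewrite [RHS]mulr_suml; apply: eq_bigr => p _.
  by rewrite !mulrA.
by rewrite sum_e1 mulr1 -valV_comm -[_ * val w]mulrA -valVM wr mulr1 i1Z mulrA.
Qed.

(** After expansion, the first factor acts on m through x_i E E_M(d y_i a m), up
    to chi(w)^-1; moving d to the end by [EE1_sym] collapses the sum over i to
    E_M(a m d), and [dual2_contract] reassembles a m. *)
Lemma act_cancel a m :
  \sum_(p <- repr (Delta a)) j (act p.1 m) * val p.2 = val a * j m.
Proof.
pose H x := j (lam^-1 *: EM (x * j m * e)).
have lH : linear H.
  move=> c x y; rewrite /H !mulrDl -!scalerAl linearP scalerDr scalerA mulrC.
  rewrite -scalerA.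
  exact: linearP.
transitivity (\sum_(p <- repr (Delta a)) H (val p.1) * val p.2).
  by apply: eq_bigr => p _; rewrite actE.
rewrite (@comult_expand D2 H val a (dual2P hMarkov hprod sP fP wr)) //.
rewrite -[RHS](dual2_contract sP fP wl); apply: eq_bigr => d _; congr (_ * _).
rewrite -i1M /H; congr (j _).
transitivity (lam^-1 *: EM (j (EM (val a * j m * val d.1)) * val w' * e));
  last first.
  rewrite -mulrA (chi_e1 w') mulrA -i1M E1_mull E1_e1 -scalerAr mulr1 lamK //.
congr (_ *: EM _).
transitivity (val w' * j (\sum_(p <- dbas F)
    p.1 * i (E (p.2 * EM (val a * j m * val d.1)))) * e).
  rewrite -!mulrA; congr (_ * _); rewrite [LHS]mulr_suml i1_sum [RHS]mulr_suml.
  apply: eq_bigr => p _; rewrite -!mulrA [j (EM _) * _]mulrA -i1M -E1_mulr.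
  rewrite [e * (_ * e)]mulrA e1_mid -!mulrA.
  rewrite (EE1_sym hMarkov sP ndU _ (valP d.1)).
  by rewrite -!mulrA E1_mull mulrA i1M.
by rewrite dbasr valV_comm.
Qed.

(** Both sides have the same scalar products with A. The factors w and w^-1
    coming from the counit and the comultiplication cancel under the trace, and
    the sum over x_i, y_i collapses because E(x_i) y_i = 1. *)
Lemma eps_tE h :
  val (eps_t Delta (counit T w) h) = lam^-1 *: j (EM (val h * e)).
Proof.
apply: (T1_inj T1_nd); first exact: valP.
  by apply/rpredZ/i1_cent/E1_cent; apply: rpredM (valP h) (e1_cent F).
move=> d dA; pose d' : A F := exist _ d dA.
rewrite /eps_t /tlift valA_sum mulr_suml T1_sum.
transitivity (lam^-1 * T1 ((\sum_(p <- repr (Delta 1))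
   T1 (val p.2 * val d') *: val p.1) * val h * e * val w)).
  rewrite -!mulrA [X in _ = _ * T1 X]mulr_suml T1_sum mulr_sumr.
  apply: eq_bigr => p _.
  rewrite valAZ (counitE T w) -!scalerAl !T1Z valAM -!mulrA; congr (_ * _).
  exact: mulrC.
rewrite (comult_T1 hMarkov T1_nd wl hDelta) -scalerAl T1Z; congr (_ * _).
have -> : val d' = d by [].
have -> : val (1 : A F) = 1 by [].
rewrite (T1C hMarkov) !mulrA -valVM wl mul1r -[_ * val h * e]mulrA.
rewrite [X in T1 X]mulr_suml T1_sum.
transitivity (\sum_(p <- dbas F)
    T1 (j (EM (d * (j (i (E p.1) * p.2)))) * (val h * e))).
  apply: eq_bigr => p _; rewrite mulr1 -[j p.1 * e * _ * _]mulrA (T1C hMarkov).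
  rewrite -!mulrA [e * (j _ * e)]mulrA e1_midr !mulrA (T1C hMarkov) !mulrA -i1M.
  by rewrite -E1_mull mulrA (centralizerP _ _ dA) [j (i _ * _)]i1M !mulrA.
rewrite -T1_sum -mulr_suml -i1_sum -E1_sum -mulr_sumr -i1_sum dbas1l rmorph1.
rewrite mulr1.
by rewrite T1_mull -T1_mulr (T1C hMarkov).
Qed.

End Action.

(** * The isomorphism *)

Section SmashIso.
Variables (k : fieldType) (F : ssext k).
Variable s : seq (A F * A F).
Hypothesis sP : dual_bases (i1 F) (E1 F) [seq (val p.1, val p.2) | p <- s].
Variable Delta : {linear A F -> tensk (A F) (A F)}.
Variable eps : A F -> k.
Variable act : A F -> M0 F -> M0 F.
Local Notation lam := (lam F).
Hypothesis actE : forall a m, act a m = lam^-1 *: E1 F (val a * i1 F m * e1 F).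
Hypothesis act_cancel : forall a m,
  \sum_(p <- repr (Delta a)) i1 F (act p.1 m) * val p.2 = val a * i1 F m.
Hypothesis eps_tE :
  forall h, val (eps_t Delta eps h) = lam^-1 *: i1 F (E1 F (val h * e1 F)).

Local Notation H := (smash Delta eps act).
Local Notation spure := (smash_pure Delta eps act).
Local Notation Ht := (target_subalg Delta eps).

Lemma act_target (z : Ht) : i1 F (act (sval z) 1) = val (sval z).
Proof.
case: z => z [h zh]; change (i1 F (act z 1) = val z).
rewrite zh actE rmorph1 mulr1 [val (eps_t _ _ _)]eps_tE.
by rewrite -scalerAl E1Z E1_mull E1_e1 -scalerAr mulr1 lamK i1Z.
Qed.

(** The target counital map fixes the copy of U in A. *)
Lemma target_surj u : u \in centralizer (incl F) ->
  exists z : Ht, act (sval z) 1 = u /\ val (sval z) = i1 F u.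
Proof.
move=> uU; pose h : A F := exist _ (i1 F u) (i1_cent uU).
pose z : Ht := exist _ (eps_t Delta eps h) (ex_intro _ h erefl).
have vz : val (sval z) = i1 F u.
  have -> : sval z = eps_t Delta eps h by [].
  rewrite eps_tE; have -> : val h = i1 F u by [].
  by rewrite E1_mull E1_e1 -scalerAr mulr1 i1Z lamK.
exists z; split=> //.
by rewrite -[LHS]E1_id act_target vz E1_id.
Qed.

Lemma smash_map_balanced :
  balanced (fun x (z : Ht) => x * act (sval z) 1) (fun z h => sval z * h)
    (fun m (a : A F) => i1 F m * val a).
Proof.
split=> [a c x x'|m c a a'|m z a].
- by rewrite linearP mulrDl -scalerAl.
- by rewrite valAD valAZ mulrDr scalerAr.
- by rewrite i1M act_target valAM mulrA.
Qed.

Definition smash_map (t : H) : M1 F :=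
  tlift (fun m (a : A F) => i1 F m * val a) t.

Lemma smash_map_linear : linear smash_map.
Proof. exact: (tlift_linear smash_map_balanced). Qed.
HB.instance Definition _ :=
  GRing.isLinear.Build k H (M1 F) *:%R smash_map smash_map_linear.

Lemma smash_map_pure m a : smash_map (spure m a) = i1 F m * val a.
Proof. exact: (tliftE smash_map_balanced). Qed.

Definition smash_inv (x : M1 F) : H :=
  \sum_(q <- s) spure (E1 F (x * val q.1)) q.2.

Lemma smash_inv_linear : linear smash_inv.
Proof.
move=> c x y; rewrite /smash_inv scaler_sumr -big_split; apply: eq_bigr => q _.
by rewrite mulrDl -scalerAl linearP /= -[RHS]/(c *: pure _ _ _ _ + pure _ _ _ _)
  -pureZl -pureDl.
Qed.
HB.instance Definition _ :=
  GRing.isLinear.Build k (M1 F) H *:%R smash_inv smash_inv_linear.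

Lemma smash_invK : cancel smash_inv smash_map.
Proof.
move=> x; rewrite /smash_inv linear_sum /= -[RHS](sum_sl sP).
by apply: eq_bigr => q _; rewrite smash_map_pure.
Qed.

Lemma spure_sumr m I (r : seq I) (h : I -> A F) :
  \sum_(q <- r) spure m (h q) = spure m (\sum_(q <- r) h q).
Proof.
elim: r => [|q r IH]; rewrite ?big_nil ?big_cons.
  by have := pureZr (fun x (z : Ht) => x * act (sval z) 1)
    (fun z h => sval z * h) 0 m 0; rewrite !scale0r.
by rewrite IH [in RHS]/smash_pure pureDr.
Qed.

(** The balancing relations over the target subalgebra are exactly those over U.
    *)
Lemma spure_U m u (uU : u \in centralizer (incl F)) a :
  spure (m * u) a = spure m ((exist _ (i1 F u) (i1_cent uU) : A F) * a).
Proof.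
have [z [zu vz]] := target_surj uU; rewrite -{1}zu.
rewrite [LHS](pure_bal (fun x (z : Ht) => x * act (sval z) 1)
  (fun z h => sval z * h)).
by congr (pure _ _ _ (_ * _)); apply: val_inj.
Qed.

Lemma smash_mapK : cancel smash_map smash_inv.
Proof.
move=> t; elim/tens_ind: t => [|m a|x y hx hy].
- by rewrite !linear0.
- rewrite -[pure _ _ m a]/(spure m a) smash_map_pure /smash_inv.
  have aU (q : A F * A F) : E1 F (val a * val q.1) \in centralizer (incl F).
    by apply: E1_cent; apply: rpredM (valP _) (valP _).
  under eq_bigr => q _ do rewrite -mulrA E1_mull (spure_U _ (aU q)).
  rewrite spure_sumr; congr (spure _ _); apply: val_inj.
  rewrite valA_sum -[RHS](sum_sl sP).
  by apply: eq_bigr => q _; rewrite valAM.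
- by rewrite !linearD /= hx hy.
Qed.

(** The product is transported from M_1, so that its axioms are immediate; that
    it is given by the smash product formula is [act_cancel]. *)
Definition smash_mul (p q : H) : H := smash_inv (smash_map p * smash_map q).

Lemma smash_mulP : smash_algebra smash_mul.
Proof.
have h1 : smash_map (spure 1 1) = 1 by rewrite smash_map_pure rmorph1 mul1r.
split; first split.
- by move=> p c x y; rewrite /smash_mul linearP mulrDr -scalerAr linearP.
- by move=> p c x y; rewrite /smash_mul linearP mulrDl -scalerAl linearP.
- by move=> p q r; rewrite /smash_mul !smash_invK mulrA.
- by move=> p; rewrite /smash_mul h1 mul1r smash_mapK.
- by move=> p; rewrite /smash_mul h1 mulr1 smash_mapK.
move=> x h y g; rewrite /smash_mul !smash_map_pure.
apply: (can_inj smash_mapK); rewrite smash_invK.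
rewrite /tlift linear_sum.
transitivity (i1 F x * (val h * i1 F y) * val g); first by rewrite !mulrA.
rewrite -act_cancel mulr_sumr [LHS]mulr_suml; apply: eq_bigr => p _.
by rewrite /= smash_map_pure i1M valAM !mulrA.
Qed.

Lemma smash_iso :
  exists mul : H -> H -> H, smash_algebra mul /\
    exists theta : {linear H -> M1 F},
      [/\ bijective theta,
          forall (m : M0 F) (a : A F), theta (spure m a) = i1 F m * val a,
          theta (spure 1 1) = 1
        & forall p q, theta (mul p q) = theta p * theta q].
Proof.
exists smash_mul; split; first exact: smash_mulP.
exists smash_map; split.
- exact: (Bijective smash_mapK smash_invK).
- exact: smash_map_pure.
- by rewrite [LHS](smash_map_pure 1 1) rmorph1 mul1r.
- by move=> p q; exact: smash_invK.
Qed.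

End SmashIso.

Theorem theorem4p6 (k : fieldType) (F : ssext k) (T : {scalar base F})
  (hMarkov : symmetric_markov T)
  (hprod : symmetric_product F \/ forall u : U F, T0 T (val u) = T1 T (phi u))
  (hirr : weakly_irreducible T)
  (hdepth : depth2 F)
  (f : tensk (V F) (V F)) (hf : sym_sep_element f)
  (w : V F) (hwl : w * slice_T T f = 1) (hwr : slice_T T f * w = 1)
  (SB : {linear B F -> B F}) (hSBbij : bijective SB)
  (hSB : forall (a : A F) (b : B F), pairing T w a b = pairing' T w a (SB b))
  (Delta : {linear A F -> tensk (A F) (A F)}) (hDelta : is_comult T w Delta)
  (S : {linear A F -> A F})
  (hS : forall (a : A F) (b : B F), pairing T w (S a) b = pairing T w a (SB b))
  (act : A F -> M0 F -> M0 F) (hact : is_adj_action Delta S act) :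
  exists mul : smash Delta (counit T w) act -> smash Delta (counit T w) act ->
      smash Delta (counit T w) act,
    smash_algebra mul /\
    exists theta : {linear smash Delta (counit T w) act -> M1 F},
      [/\ bijective theta,
          forall (m : M0 F) (a : A F),
            theta (smash_pure Delta (counit T w) act m a) = i1 F m * val a,
          theta (smash_pure Delta (counit T w) act 1 1) = 1
        & forall p q, theta (mul p q) = theta p * theta q].
Proof.
case: hirr => _ ndU; case: hdepth => -[s sP] _.
apply: (smash_iso sP).
- exact: (actE hMarkov hprod ndU sP hf hwl hwr hDelta hSB hS hact).
- exact: (act_cancel hMarkov hprod ndU sP hf hwl hwr hDelta hSB hS hact).
- exact: (eps_tE hMarkov ndU sP hwl hDelta).
Qed.
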